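(* Let $G$ be a noncompact unimodular locally compact group. Then $\mathrm{TLIM}_0(G)=\mathrm{TLIM}(G)$.
   Context: $|E|$ denotes the left Haar measure of $E\subset G$. $\mathcal L_\infty(G)$ is the usual space with respect to Haar measure, identified with the dual of $\mathcal L_1(G)$. The set of means is $\mathcal M(G)=\{\mu\in\mathcal L_\infty^*(G): \|\mu\|=1,\ \mu\ge 0\}$. Each $f\in\mathcal L_1(G)$ is regarded as an element of $\mathcal L_\infty^*(G)$ via $\phi\mapsto\int_G f\phi$; $\mathcal M_1(G)=\{f\in\mathcal L_1(G):\|f\|_1=1,\ f\ge0\}$. Write $l_x\phi(y)=\phi(x^{-1}y)$ and, for $f\in\mathcal M_1(G)$, $\phi\in\mathcal L_\infty(G)$, $f*\phi=\int_G f(x)\,l_x\phi\,dx$. The topological left-invariant means are $\mathrm{TLIM}(G)=\{\mu\in\mathcal M(G): \mu(\phi)=\mu(f*\phi)\ \text{for all } f\in\mathcal M_1(G),\ \phi\in\mathcal L_\infty(G)\}$. For a compact set $A\subset G$ of positive measure, $\mu_A=\chi_A/|A|$. For $K\subset G$ and $\epsilon>0$, $\mathscr C^+(K,\epsilon)$ is the set of compact $A\subset G$ with $|A|>0$ and $|xA\triangle A|/|A|<\epsilon$ for all $x\in K$. For a mean $\mu$ write $\mu(E)=\mu(\chi_E)$. For a finite measurable partition $\mathcal P$ of $G$ and $\epsilon\in(0,1)$, $\mathcal N(\mu,\mathcal P,\epsilon)=\{\nu\in\mathcal M(G): |\mu(E)-\nu(E)|<\epsilon\ \text{for all } E\in\mathcal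 P\}$. Then $\mathrm{TLIM}_0(G)$ is the set of $\mu\in\mathrm{TLIM}(G)$ such that for every finite measurable partition $\mathcal P$ of $G$, every compact $K\subset G$ and every $\epsilon\in(0,1)$ there is $A\in\mathscr C^+(K,\epsilon)$ with $\mu_A\in\mathcal N(\mu,\mathcal P,\epsilon)$. *)

(* Defs.v *)
From HB Require Import structures.
From mathcomp Require Import all_boot all_order all_algebra.
From mathcomp Require Import all_classical all_reals all_analysis.

Set Implicit Arguments.
Unset Strict Implicit.
Unset Printing Implicit Defensive.

Import Order.TTheory GRing.Theory Num.Theory.
Import numFieldNormedType.Exports.

Local Open Scope classical_set_scope.
Local Open Scope ring_scope.

HB.mixin Record isTopologicalGroup G & Group G & Topological G := {
  mulg_continuous : continuous (fun p : G * G => (p.1 * p.2)%g) ;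
  invg_continuous : continuous (fun x : G => (x^-1)%g)
}.

(* The distinguished point is unused: it is only required by the library's
   construction of generated sigma-algebras. *)
#[short(type="topologicalGroupType")]
HB.structure Definition TopologicalGroup :=
  {G of Group G & PointedTopological G & isTopologicalGroup G}.

Notation borel G := (g_sigma_algebraType (@open G)).

Section Haar.
Context {R : realType} {G : topologicalGroupType}.
Implicit Types (h : {measure set (borel G) -> \bar R}) (E : set (borel G)).

Definition ltranslate (x : G) (A : set G) : set G := [set (x * y)%g | y in A].
Definition rtranslate (A : set G) (x : G) : set G := [set (y * x)%g | y in A].

(* Radon measures are those that are finite on compact sets, outer regular on
   Borel sets and inner regular on open sets. *)
Definition left_haar h : Prop :=
  [/\ h setT != 0%E,
      (forall x E, measurable E -> h (ltranslate x E) = h E),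
      (forall K : set G, compact K -> (h K < +oo)%E),
      (forall E, measurable E ->
         h E = ereal_inf [set h U | U in [set U : set G | open U /\ E `<=` U]]) &
      (forall U : set G, open U ->
         h U = ereal_sup [set h K | K in [set K : set G | compact K /\ K `<=` U]])].

(* The modular function is 1, i.e. the left Haar measure is right invariant. *)
Definition unimodular h : Prop :=
  forall x E, measurable E -> h (rtranslate E x) = h E.

End Haar.

(* G need not be sigma-compact, so for L_oo to be the dual of L_1 measurability
   and null sets have to be taken locally, i.e. on Borel sets of finite
   measure. *)
Section Linfty.
Context {R : realType} {G : topologicalGroupType}.
Variable h : {measure set (borel G) -> \bar R}.
Implicit Types (E : set G) (f : G -> R).

Definition loc_measurable E : Prop :=
  forall F : set (borel G), measurable F -> (h F < +oo)%E ->
    measurable (E `&` F : set (borel G)).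

Definition loc_ae (P : set G) : Prop :=
  forall F : set (borel G), measurable F -> (h F < +oo)%E ->
    h.-negligible (~` P `&` F).

Definition loc_measurable_fun f : Prop :=
  forall F : set (borel G), measurable F -> (h F < +oo)%E ->
    measurable_fun F (f : borel G -> R).

Definition ess_bounded f : Prop := exists c : R, loc_ae [set x | `|f x| <= c].

Definition Linfty_pred : {pred G -> R} :=
  mem [set f | loc_measurable_fun f /\ ess_bounded f].

Lemma Linfty_submod_closed : submod_closed Linfty_pred.
Proof.
split.
  rewrite inE; split; first by move=> F _ _; exact: measurable_cst.
  exists 0 => F mF _; apply: negligibleS (negligible_set0 h).
  by move=> x [] /=; rewrite normr0 lexx.
move=> a f g; rewrite !inE => -[mf [c fc]] [mg [d gd]]; split.
  move=> F mF Foo; apply: measurable_realfun.measurable_funD; last exact: mg.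
  by apply: measurable_realfun.measurable_funM; [exact: measurable_cst|exact: mf].
exists (`|a| * c + d) => F mF Foo.
apply: negligibleS (negligibleU (fc F mF Foo) (gd F mF Foo)) => x [/= fx Fx].
rewrite /setC /=; have [fxc|/negP] := boolP (`|f x| <= c); last by left.
right; split => // gxd; apply: fx.
rewrite (le_trans (ler_normD _ _))// lerD// normrM.
exact: ler_wpM2l.
Qed.

HB.instance Definition _ :=
  GRing.isSubmodClosed.Build R (G -> R) Linfty_pred Linfty_submod_closed.

(* Bounded functionals for the seminorm [Linfty_norm] are the same as bounded
   functionals on classes modulo local a.e. equality. *)
Record Linfty := MkLinfty
  { Linfty_val :> G -> R ; LinftyP : Linfty_val \in Linfty_pred }.

HB.instance Definition _ := [isSub for Linfty_val].
HB.instance Definition _ := [Choice of Linfty by <:].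
HB.instance Definition _ := [SubChoice_isSubLmodule of Linfty by <:].

(* The default value 0 outside L_oo is never used: below, f is either the
   indicator of a measurable set or a convolution of L_1 and L_oo functions. *)
Definition Linfty_of f : Linfty := insubd 0 f.

Definition Linfty_norm (phi : Linfty) : R :=
  inf [set c : R | loc_ae [set x | `|phi x| <= c]].

Definition dual_norm (mu : Linfty -> R) : \bar R :=
  ereal_sup [set `|mu phi|%:E | phi in [set phi | Linfty_norm phi <= 1]].

Definition means : set (Linfty -> R) :=
  [set mu | [/\ scalar mu, dual_norm mu = 1%E &
    forall phi : Linfty, loc_ae [set x | 0 <= phi x] -> 0 <= mu phi]].

Definition mean_set (mu : Linfty -> R) E : R := mu (Linfty_of \1_E).

Definition L1_functional f : Linfty -> R :=
  fun phi => \int[h]_(x in [set: borel G]) (f x * phi x).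

Definition M1 : set (G -> R) :=
  [set f | [/\ f \in Lfun h 1%E, 'N[h]_1[EFin \o f]%E = 1%E &
    {ae h, forall x, 0 <= f x}]].

Definition ltrans (x : G) (phi : G -> R) : G -> R :=
  fun y => phi (x^-1 * y)%g.

Definition convolution f (phi : G -> R) : G -> R :=
  fun y => \int[h]_(x in [set: borel G]) (f x * ltrans x phi y).

Definition TLIM : set (Linfty -> R) :=
  [set mu | means mu /\
    forall f (phi : Linfty), M1 f -> mu phi = mu (Linfty_of (convolution f phi))].

Definition mu_ (A : set G) : Linfty -> R :=
  L1_functional (fun x => \1_A x / fine (h A)).

Definition folner (K : set G) (eps : R) : set (set G) :=
  [set A | [/\ compact A, (0 < h A)%E &
    forall x, K x -> fine (h (ltranslate x A `+` A)) / fine (h A) < eps]].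

Definition finite_measurable_partition (P : set (set G)) : Prop :=
  [/\ finite_set P, partition P id [set: G] &
      forall E, P E -> loc_measurable E].

Definition mean_nbhs (mu : Linfty -> R) (P : set (set G)) (eps : R) :
    set (Linfty -> R) :=
  [set nu | means nu /\
    forall E, P E -> `|mean_set mu E - mean_set nu E| < eps].

Definition TLIM0 : set (Linfty -> R) :=
  [set mu | TLIM mu /\
    forall (P : set (set G)) (K : set G) (eps : R),
      finite_measurable_partition P -> compact K -> 0 < eps < 1 ->
      exists2 A, folner K eps A & mean_nbhs mu P eps (mu_ A)].

End Linfty.

Arguments means {R G} h.
Arguments TLIM {R G} h.
Arguments TLIM0 {R G} h.

(* Main.v *)
Require Import Defs.
From HB Require Import structures.
From mathcomp Require Import finmap.
From mathcomp Require Import all_boot all_order all_algebra.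
From mathcomp Require Import all_classical all_reals all_analysis.
From mathcomp Require Import measurable_realfun ring lra.

(** Every topological left-invariant mean [mu] is a limit of uniform
    distributions on Folner sets. Fix a finite measurable partition [P], a
    compact set [K] and [eps].

    One Folner set. Suppose that a compact set [T] of positive volume satisfies
    [|xT + T| < eps |T|] for all [x] in [K], where [+] is the symmetric
    difference. Right translates of [T] have the same volume, by unimodularity,
    and the same invariance, so every union of disjoint right translates of [T]
    is as invariant as [T]. It remains to choose the translates so that the
    uniform distribution on their union has almost the values of [mu] on [P].

    Choosing the translates. For [E] in [P] let [avg T E y] be the proportion of
    [E] in [T y]. As [y] varies it is a convolution of the indicator of [E], so
    its mean is [mu E] ([mean_avg]); this uses that inversion preserves volume
    ([vol_setinv]). Moreover [mu] vanishes on compact sets, as [G] is noncompact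
    and thus has infinite volume ([mean_compact]). Hence for all real weights
    [w E] there are points [y] outside any given compact set with
    [sum_E w E * (avg T E y - mu E) <= 1]. Choose [y_1], [y_2] and so on in this
    way, such that [T y_n] is disjoint from its predecessors and the weights are
    the current errors [sum_(i < n) (avg T E y_i - mu E)]. The sum of the squares
    of these errors then grows at most linearly in [n] ([greedy_points]), so that
    the errors divided by [n] tend to 0.

    Existence of [T]. Let [Gam] be a maximal subset of [G] for which the right
    translates [V g] of a neighbourhood [V] of 1 are disjoint, and turn it into a
    graph of bounded degree by joining [g] to [g'] when [g'] lies in [W g], for a
    suitable compact [W]. If a finite subset of [Gam] has a small edge boundary,
    the union of the translates of a larger compact set [U] by its points is a
    Folner set for all of [K] at once ([net_folner]). Otherwise the graph is
    expanding, and duality provides a flow on the edges, with values in [0, 1],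
    that has a net outflow of at least [d > 0] at each vertex ([flow_exists]).
    The sums of the indicators of [X g] and of [X g'] over the edges [(g, g')],
    weighted by the flow, then differ by at least [d] everywhere, if [X] contains
    [U]. But each [X g] is displaced to [X g'] by an element of the compact set
    [W], and [mu] cannot detect that ([mean_displaced_le]), essentially because a
    left-invariant functional on small sets is a multiple of the volume. *)

Set Implicit Arguments.
Unset Strict Implicit.
Unset Printing Implicit Defensive.
Import Order.TTheory GRing.Theory Num.Theory.
Import numFieldNormedType.Exports.
Local Open Scope classical_set_scope.
Local Open Scope ring_scope.

(** * Sets in topological groups *)

Section TopologicalGroups.
Context {G : topologicalGroupType}.
Implicit Types (x y z : G) (A B C U N : set G).

Definition setinv A : set G := [set x | A x^-1%g].
Definition setmul A B : set G := [set (a * b)%g | a in A & b in B].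

Lemma ltranslateE x A : ltranslate x A = [set z | A (x^-1 * z)%g].
Proof.
apply/seteqP; split => z /=; first by move=> [y Ay <-]; rewrite mulKg.
by move=> Az; exists (x^-1 * z)%g => //; rewrite mulVKg.
Qed.

Lemma rtranslateE A x : rtranslate A x = [set z | A (z * x^-1)%g].
Proof.
apply/seteqP; split => z /=; first by move=> [y Ay <-]; rewrite mulgK.
by move=> Az; exists (z * x^-1)%g => //; rewrite mulgVK.
Qed.

Lemma setinvK A : setinv (setinv A) = A.
Proof. by apply/seteqP; split => x; rewrite /setinv /= invgK. Qed.

Lemma setinvE A : setinv A = [set x^-1%g | x in A].
Proof.
apply/seteqP; split => x /=.
  by move=> Ax; exists x^-1%g => //; rewrite invgK.
by move=> [y Ay <-]; rewrite /setinv /= invgK.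
Qed.

Lemma lmul_continuous x : continuous (fun y : G => (x * y)%g).
Proof.
move=> y; apply: continuous2_cvg (cvg_cst _) _; last exact: cvg_id.
exact: (@mulg_continuous G (x, y)).
Qed.

Lemma rmul_continuous x : continuous (fun y : G => (y * x)%g).
Proof.
move=> y; apply: continuous2_cvg _ (cvg_cst _); last exact: cvg_id.
exact: (@mulg_continuous G (y, x)).
Qed.

Lemma open_ltranslate x A : open A -> open (ltranslate x A).
Proof.
move=> oA; rewrite ltranslateE.
by apply: (open_comp _ oA) => y _; exact: lmul_continuous.
Qed.

Lemma open_rtranslate A x : open A -> open (rtranslate A x).
Proof.
move=> oA; rewrite rtranslateE.
by apply: (open_comp _ oA) => y _; exact: rmul_continuous.
Qed.

Lemma open_setinv A : open A -> open (setinv A).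
Proof. by move=> oA; apply: (open_comp _ oA) => y _; exact: invg_continuous. Qed.

Lemma compact_ltranslate x A : compact A -> compact (ltranslate x A).
Proof.
by apply: continuous_compact; apply: continuous_subspaceT; exact: lmul_continuous.
Qed.

Lemma compact_rtranslate A x : compact A -> compact (rtranslate A x).
Proof.
by apply: continuous_compact; apply: continuous_subspaceT; exact: rmul_continuous.
Qed.

Lemma compact_setinv A : compact A -> compact (setinv A).
Proof.
rewrite setinvE; apply: continuous_compact; apply: continuous_subspaceT.
exact: invg_continuous.
Qed.

Lemma compact_setmul A B : compact A -> compact B -> compact (setmul A B).
Proof.
move=> cA cB; have -> : setmul A B = (fun p : G * G => p.1 * p.2)%g @` (A `*` B).
  apply/seteqP; split => z /=.
    by move=> [a Aa [b Bb <-]]; exists (a, b).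
  by move=> [[a b] /= [Aa Bb] <-]; exists a => //; exists b.
apply: continuous_compact (compact_setX cA cB).
by apply: continuous_subspaceT; exact: mulg_continuous.
Qed.

Lemma open_setmul A B : open B -> open (setmul A B).
Proof.
move=> oB; have -> : setmul A B = \bigcup_(a in A) ltranslate a B.
  by apply/seteqP; split => z /= [a Aa [b Bb <-]]; exists a => //; exists b.
by apply: bigcup_open => a _; exact: open_ltranslate.
Qed.

Lemma subset_setmul1 A B : B 1%g -> A `<=` setmul A B.
Proof. by move=> B1 a Aa; exists a => //; exists 1%g => //; rewrite mulg1. Qed.

Lemma nbhs1_mul N : nbhs (1%g : G) N ->
  exists2 M : set G, open_nbhs 1%g M & forall a b, M a -> M b -> N (a * b)%g.
Proof.
move=> N1; have := @mulg_continuous G (1%g, 1%g) N; rewrite /= mulg1 => /(_ N1).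
case=> -[P Q] /= [P1 Q1] PQ.
exists (P `&` Q)°; first by split; [exact: open_interior|exact: filterI].
by move=> a b /interior_subset[Pa _] /interior_subset[_ Qb]; exact: (PQ (a, b)).
Qed.

Lemma nbhs1_mul3 N : nbhs (1%g : G) N -> exists2 M : set G, open_nbhs 1%g M &
  forall a b c, M a -> M b -> M c -> N (a * b * c)%g.
Proof.
move=> /nbhs1_mul[M [oM M1] MN].
have [|L [oL L1] LM] := @nbhs1_mul M; first exact: open_nbhs_nbhs.
exists L => // a b c La Lb Lc; apply: MN; first exact: LM.
by rewrite -(mulg1 c); exact: LM.
Qed.

(** The tube lemma, in the form in which compactness is mostly used below. *)
Lemma compact_sub_near C U : compact C -> open U -> C `<=` U ->
  \forall n \near (1%g : G), forall c, C c -> U (c * n)%g.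
Proof.
move=> /compact_near_coveringP cC oU CU.
apply: (cC G (nbhs 1%g) (fun n c => U (c * n)%g)) => c Cc.
have := @mulg_continuous G (c, 1%g) U; rewrite /= mulg1; apply.
by apply: open_nbhs_nbhs; split => //; exact: CU.
Qed.

Lemma compact_sub_nearl C U : compact C -> open U -> C `<=` U ->
  \forall n \near (1%g : G), forall c, C c -> U (n * c)%g.
Proof.
move=> /compact_near_coveringP cC oU CU.
apply: (cC G (nbhs 1%g) (fun n c => U (n * c)%g)) => c Cc.
have := @mulg_continuous G (1%g, c) U; rewrite /= mul1g => UV.
have /UV[[P Q] /= [P1 Q1] PQ] : nbhs c U.
  by apply: open_nbhs_nbhs; split => //; exact: CU.
by exists (Q, P) => //= -[a b] /= [Qa Pb]; exact: (PQ (b, a)).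
Qed.

Hypothesis hG : hausdorff_space G.
Hypothesis lcG : locally_compact [set: G].

(** The closure of [M] is contained in [M M], for each neighbourhood [M] of 1. *)
Lemma compact_nbhs1 N : nbhs (1%g : G) N ->
  exists K : set G, [/\ compact K, nbhs 1%g K & K `<=` N].
Proof.
move=> /nbhs1_mul[M [oM M1] MN].
have [K0 + [cK0 clK0]] := @lcG 1%g I; rewrite withinET => K01.
exists (K0 `&` closure M); split.
- by apply: compact_closedI => //; exact: closed_closure.
- apply: filterI => //; apply: (filterS (@subset_closure _ M)).
  exact: open_nbhs_nbhs.
- move=> x [_ clx].
  have [|y [My /= yM]] := clx [set y | M (y^-1 * x)%g].
    apply: open_nbhs_nbhs; split; last by rewrite /= mulVg.
    have := open_ltranslate x (open_setinv oM).
    by rewrite ltranslateE /setinv /=; under eq_set do rewrite invgM invgK.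
  by rewrite -(mulVKg y x); exact: MN.
Qed.

Lemma closed_compact C : compact C -> closed C.
Proof. exact: compact_closed. Qed.

Lemma compact_sub_setmul C U : compact C -> open U -> C `<=` U ->
  exists K : set G, [/\ compact K, nbhs 1%g K & setmul C K `<=` U].
Proof.
move=> cC oU CU; have [K [cK K1 KU]] := compact_nbhs1 (compact_sub_near cC oU CU).
by exists K; split => // z [c Cc [k /KU kU <-]]; exact: kU.
Qed.
End TopologicalGroups.

(** * Volume of Borel sets of finite measure *)

Section HaarMeasure.
Context {R : realType} {G : topologicalGroupType}.
Variable h : {measure set (borel G) -> \bar R}.
Implicit Types (x y z : G) (A B C U N E : set G).

Definition borel_set A : Prop := measurable (A : set (borel G)).

(** On these sets passing from [h] to the real-valued [vol] loses nothing. *)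
Definition finmeas A : Prop := borel_set A /\ (h A < +oo)%E.

Definition vol A : R := fine (h A).

Lemma open_borel_set U : open U -> borel_set U.
Proof. exact: sub_gen_smallest. Qed.

Lemma continuous_measurable_group (f : G -> G) : continuous f ->
  measurable_fun [set: borel G] (f : borel G -> borel G).
Proof.
move=> cf; apply: (@measurability _ _ (borel G) (borel G) setT f (@open G)) => //.
move=> _ [U oU <-]; rewrite setTI; apply: open_borel_set.
by apply: open_comp => // x _; exact: cf.
Qed.

Lemma borel_set_preimage (f : G -> G) A : continuous f -> borel_set A ->
  borel_set (f @^-1` A).
Proof.
move=> cf mA; rewrite -[X in borel_set X]setTI.
exact: (continuous_measurable_group cf).
Qed.

Lemma borel_set_ltranslate x A : borel_set A -> borel_set (ltranslate x A).
Proof.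
rewrite ltranslateE; apply: borel_set_preimage; exact: lmul_continuous.
Qed.

Lemma borel_set_rtranslate A x : borel_set A -> borel_set (rtranslate A x).
Proof.
rewrite rtranslateE; apply: borel_set_preimage; exact: rmul_continuous.
Qed.

Lemma borel_set_setinv A : borel_set A -> borel_set (setinv A).
Proof. apply: borel_set_preimage; exact: invg_continuous. Qed.

Lemma volE A : finmeas A -> h A = (vol A)%:E.
Proof. by move=> [mA Aoo]; rewrite fineK// ge0_fin_numE. Qed.

Lemma vol_ge0 A : 0 <= vol A.
Proof. exact/fine_ge0. Qed.

Lemma finmeas_sub A B : borel_set A -> A `<=` B -> finmeas B -> finmeas A.
Proof.
move=> mA AB [mB Boo]; split => //.
by apply: le_lt_trans Boo; apply: le_measure; rewrite ?inE.
Qed.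

Lemma le_vol A B : borel_set A -> A `<=` B -> finmeas B -> vol A <= vol B.
Proof.
move=> mA AB fB; rewrite -lee_fin -!volE//; last exact: finmeas_sub fB.
by apply: le_measure; rewrite ?inE//; case: fB.
Qed.

Lemma finmeasU A B : finmeas A -> finmeas B -> finmeas (A `|` B).
Proof.
move=> [mA Aoo] [mB Boo]; split; first exact: measurableU.
by apply: (le_lt_trans (measureU2 h mA mB)); exact: lte_add_pinfty.
Qed.

Lemma vol_setU A B : finmeas A -> finmeas B -> A `&` B = set0 ->
  vol (A `|` B) = vol A + vol B.
Proof.
move=> fA fB AB; apply: EFin_inj; rewrite EFinD -!volE//; last exact: finmeasU.
by rewrite measureU//; [case: fA|case: fB].
Qed.

Lemma vol_setUI A B : finmeas A -> borel_set B ->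
  vol A = vol (A `&` B) + vol (A `\` B).
Proof.
move=> fA mB; have [mA _] := fA.
rewrite -vol_setU.
- by rewrite setUIDK.
- by apply: (finmeas_sub _ _ fA); [exact: measurableI|exact: subIsetl].
- by apply: (finmeas_sub _ _ fA); [exact: measurableD|exact: subDsetl].
- by rewrite setDE setIACA setICr setI0.
Qed.

Lemma vol_setD A B : finmeas A -> borel_set B -> B `<=` A ->
  vol (A `\` B) = vol A - vol B.
Proof.
by move=> fA mB BA; rewrite (vol_setUI fA mB) (setIidr BA) addrC addKr.
Qed.

Lemma finmeas_fbigcup (I : choiceType) (D : set I) (F : I -> set G) :
  finite_set D -> (forall i, D i -> finmeas (F i)) ->
  finmeas (\bigcup_(i in D) F i).
Proof.
move=> fD fF; have mU : borel_set (\bigcup_(i in D) F i).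
  by apply: fin_bigcup_measurable => // i /fF[].
split => //.
have /le_lt_trans := @content_sub_fsum _ _ _ h _ _ _ F fD
  (fun i Di => (fF i Di).1) mU (fun _ Fx => Fx).
apply; rewrite fsbig_finite//= big_seq; apply: lte_sum_pinfty => i.
by rewrite in_fset_set// inE => /fF[].
Qed.

Lemma vol_fbigcup_le (I : choiceType) (D : set I) (F : I -> set G) A :
  finite_set D -> (forall i, D i -> finmeas (F i)) -> borel_set A ->
  A `<=` \bigcup_(i in D) F i -> vol A <= \sum_(i \in D) vol (F i).
Proof.
move=> fD fF mA AF; rewrite -lee_fin -fsumEFin//.
rewrite -volE; last exact: (finmeas_sub mA AF (finmeas_fbigcup fD fF)).
have -> : (\sum_(i \in D) (vol (F i))%:E = \sum_(i \in D) h (F i))%E.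
  by apply: eq_fsbigr => i /set_mem/fF/volE.
exact: (@content_sub_fsum _ _ _ h _ _ _ F fD (fun i Di => (fF i Di).1) mA AF).
Qed.

Lemma vol_fbigcup (I : choiceType) (D : set I) (F : I -> set G) :
  finite_set D -> trivIset D F -> (forall i, D i -> finmeas (F i)) ->
  vol (\bigcup_(i in D) F i) = \sum_(i \in D) vol (F i).
Proof.
move=> fD tF fF; apply: EFin_inj; rewrite -fsumEFin//.
rewrite -volE; last exact: finmeas_fbigcup.
rewrite measure_fin_bigcup//; last by move=> i /fF[].
by apply: eq_fsbigr => i /set_mem/fF/volE.
Qed.

Section Haar.
Hypothesis hG : hausdorff_space G.
Hypothesis lcG : locally_compact [set: G].
Hypothesis haarh : left_haar h.

Lemma compact_finmeas C : compact C -> finmeas C.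
Proof.
move=> cC; split; last by case: haarh => _ _ + _ _; exact.
rewrite -[C]setCK; apply: measurableC; apply: open_borel_set.
by rewrite openC; exact: closed_compact.
Qed.

Lemma compact_borel_set C : compact C -> borel_set C.
Proof. by move=> /compact_finmeas[]. Qed.

Lemma sub_compact_finmeas A C : borel_set A -> A `<=` C -> compact C ->
  finmeas A.
Proof. by move=> mA AC /compact_finmeas; exact: finmeas_sub. Qed.

Lemma finmeas_ltranslate x A : finmeas A -> finmeas (ltranslate x A).
Proof.
move=> [mA Aoo]; split; first exact: borel_set_ltranslate.
by case: haarh => _ -> // .
Qed.

Lemma vol_ltranslate x A : borel_set A -> vol (ltranslate x A) = vol A.
Proof. by move=> mA; rewrite /vol; case: haarh => _ ->. Qed.

Lemma outer_regular A e : finmeas A -> 0 < e ->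
  exists U : set G, [/\ open U, A `<=` U, finmeas U & vol U < vol A + e].
Proof.
move=> fA e0; have [mA _] := fA; have [_ _ _ outer _] := haarh.
have : h A \is a fin_num by rewrite volE.
rewrite outer// => /(lb_ereal_inf_adherent e0)[_ [U [oU AU] <-]].
rewrite -outer// => UA.
have fU : finmeas U.
  split; first exact: open_borel_set.
  by apply: lt_trans UA _; rewrite volE// -EFinD ltry.
by exists U; split => //; rewrite -lte_fin EFinD -!volE.
Qed.

(** Otherwise all compact sets, being covered by finitely many translates of
    [U], would be null, and by inner regularity [G] would be null. *)
Lemma open_vol_gt0 U : open U -> finmeas U -> U !=set0 -> 0 < vol U.
Proof.
move=> oU fU [u Uu]; rewrite lt_neqAle vol_ge0 andbT eq_sym.
apply/negP => /eqP U0; have [hT hl _ _ inner] := haarh.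
move: hT; rewrite (inner setT openT) => /eqP; apply.
apply/eqP; rewrite eq_le; apply/andP; split; last first.
  by apply: ereal_sup_ubound; exists set0; rewrite ?measure0//; split => //; exact: compact0.
apply: ub_ereal_sup => _ [K [cK _] <-].
move: (cK); rewrite compact_cover => /(_ G K (fun x => ltranslate (x * u^-1)%g U)).
have hK : borel_set K by exact: compact_borel_set.
case => [x _|x Kx|D DK KD].
- exact: open_ltranslate.
- by exists x => //; exists u => //; rewrite mulgVK.
have := @content_sub_fsum _ _ _ h _ _ _ _ (finite_fset D)
  (fun x _ => borel_set_ltranslate (x * u^-1)%g (proj1 fU)) hK KD.
rewrite fsbig1 => [//|x _].
by apply: (etrans (hl _ _ (proj1 fU))); rewrite volE// U0.
Qed.

Lemma nbhs1_vol_gt0 N : nbhs (1%g : G) N -> compact N -> 0 < vol N.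
Proof.
move=> N1 /compact_finmeas fN.
have fI : finmeas N°.
  apply: (finmeas_sub _ (@interior_subset _ _) fN).
  by apply: open_borel_set; exact: open_interior.
apply: (@lt_le_trans _ _ (vol N°)).
  by apply: open_vol_gt0 => //; [exact: open_interior|exists 1%g].
by apply: le_vol => //; [case: fI|exact: interior_subset].
Qed.

Lemma integral_step (I : Type) (s : seq I) (b : I -> R) (E : I -> set G) :
  (forall i, 0 <= b i) -> (forall i, finmeas (E i)) ->
  (\int[h]_(y in [set: borel G]) (\sum_(i <- s) b i * \1_(E i) y)%:E =
   (\sum_(i <- s) b i * vol (E i))%:E)%E.
Proof.
move=> b0 fE; under eq_integral do rewrite -sumEFin.
rewrite ge0_integral_sum//=.
- rewrite -sumEFin; apply: eq_bigr => i _; under eq_integral do rewrite EFinM.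
  have [mE _] := fE i.
  rewrite ge0_integralZl_EFin//; last first.
    by apply/measurable_EFinP; exact: measurable_indic.
  by rewrite integral_indic// setIT EFinM -volE.
- move=> i; apply/measurable_EFinP; apply: measurable_funM => //.
  by apply: measurable_indic; case: (fE i).
- by move=> i y _; rewrite lee_fin mulr_ge0.
Qed.

Lemma Rintegral_step (I : Type) (s : seq I) (b : I -> R) (E : I -> set G) :
  (forall i, 0 <= b i) -> (forall i, finmeas (E i)) ->
  \int[h]_(y in [set: borel G]) (\sum_(i <- s) b i * \1_(E i) y) =
  \sum_(i <- s) b i * vol (E i).
Proof. by move=> b0 fE; rewrite /Rintegral integral_step. Qed.

(** Both sides are integrals of step functions. Comparing these pointwise
    replaces Fubini's theorem, whose measurability hypotheses can fail if [G] is
    not second countable. *)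
Lemma step_le (I J : Type) (s : seq I) (t : seq J) (a : I -> R) (b : J -> R)
    (A : I -> set G) (B : J -> set G) :
  (forall i, 0 <= a i) -> (forall i, finmeas (A i)) ->
  (forall j, 0 <= b j) -> (forall j, finmeas (B j)) ->
  (forall y, \sum_(i <- s) a i * \1_(A i) y <= \sum_(j <- t) b j * \1_(B j) y) ->
  \sum_(i <- s) a i * vol (A i) <= \sum_(j <- t) b j * vol (B j).
Proof.
move=> a0 fA b0 fB ab; rewrite -lee_fin -!integral_step//.
have mstep K (u : seq K) (d : K -> R) (D : K -> set G) :
    (forall k, finmeas (D k)) ->
    measurable_fun [set: borel G] (fun y => (\sum_(k <- u) d k * \1_(D k) y)%:E).
  move=> fD; apply/measurable_EFinP; apply: measurable_sum => k.
  by apply: measurable_funM => //; apply: measurable_indic; case: (fD k).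
apply: ge0_le_integral => //.
- by move=> y _; rewrite lee_fin sumr_ge0// => i _; rewrite mulr_ge0.
- exact: mstep.
- exact: mstep.
- by move=> y _; rewrite lee_fin; exact: ab.
Qed.

Lemma vol_step_le A (a : R) n (b : 'I_n -> R) (E : 'I_n -> set G) :
  finmeas A -> 0 <= a -> (forall j, 0 <= b j) -> (forall j, finmeas (E j)) ->
  (forall y, A y -> a <= \sum_(j < n) b j * \1_(E j) y) ->
  a * vol A <= \sum_(j < n) b j * vol (E j).
Proof.
move=> fA a0 b0 fE ab.
have := @step_le _ _ [:: tt] (index_enum 'I_n) (fun=> a) b (fun=> A) E.
rewrite big_seq1; apply => // y; rewrite big_seq1 indicE.
case: (asboolP (A y)) => Ay; first by rewrite mem_set// mulr1; exact: ab.
by rewrite memNset// mulr0 sumr_ge0// => j _; rewrite mulr_ge0.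
Qed.

Section Unimodular.
Hypothesis uh : unimodular h.

Lemma vol_rtranslate A x : borel_set A -> vol (rtranslate A x) = vol A.
Proof. by move=> mA; rewrite /vol uh. Qed.

Lemma finmeas_rtranslate A x : finmeas A -> finmeas (rtranslate A x).
Proof. by move=> [mA Aoo]; split; [exact: borel_set_rtranslate|rewrite uh]. Qed.

End Unimodular.
End Haar.
End HaarMeasure.

(** * Invariance of volume under inversion *)

Section Inversion.
Context {R : realType} {G : topologicalGroupType}.
Variable h : {measure set (borel G) -> \bar R}.
Implicit Types (x y z : G) (A B C D U N E : set G).
Hypothesis hG : hausdorff_space G.
Hypothesis lcG : locally_compact [set: G].
Hypothesis haarh : left_haar h.
Hypothesis uh : unimodular h.
Local Notation vol := (vol h).
Local Notation finmeas := (finmeas h).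

(** The translates of a set by the points of one such piece are nearly the
    same, so that the pieces can serve as the cells of a Riemann sum. *)
Lemma compact_pieces B N : compact B -> nbhs (1%g : G) N ->
  exists n (x : nat -> G) (F : nat -> set G),
    [/\ forall j, borel_set (F j), trivIset `I_n F, \bigcup_(j in `I_n) F j = B
      & forall j, (j < n)%N -> F j `<=` ltranslate (x j) N].
Proof.
move=> cB N1; have oN := open_interior N.
have := cB; rewrite compact_cover.
move=> /(_ G B (fun x => ltranslate x (N°))) [x _|x Bx|D DB BD].
- exact: open_ltranslate.
- by exists x => //; exists 1%g => //; rewrite mulg1.
pose s := finmap.enum_fset D.
pose x j := nth 1%g s j.
pose H j := B `&` ltranslate (x j) (N°).
exists (size s), x, (seqDU H); split.
- move=> j; apply: measurableD; last first.
    apply: bigsetU_measurable => k _; apply: measurableI.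
      exact: (compact_borel_set hG haarh).
    by apply: borel_set_ltranslate; exact: open_borel_set.
  apply: measurableI; first exact: (compact_borel_set hG haarh).
  by apply: borel_set_ltranslate; exact: open_borel_set.
- exact: sub_trivIset (trivIset_seqDU H).
- rewrite bigcup_mkord -bigsetU_seqDU -bigcup_mkord.
  apply/seteqP; split => y; first by move=> [j _ []].
  move=> By; have [z Dz zy] := BD _ By.
  have sz : z \in s by [].
  exists (index z s); first by rewrite /= index_mem.
  by split => //; rewrite /x nth_index.
- move=> j _ y [[_ [n Nn <-]] _]; exists n => //; exact: interior_subset.
Qed.

(** The comparison behind the uniqueness of Haar measure: for a small set [K],
    the indicator of [A] times [vol K] is below a combination of indicators of
    left translates of the inverse of [O], a set slightly larger than [K], with
    total weight close to [vol A]. Evaluating the left-invariant measure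
    [vol \o setinv] on both sides shows that inversion does not increase volume. *)
Lemma vol_setinv_le A : compact A -> vol (setinv A) <= vol A.
Proof.
move=> cA; apply/ler_addgt0Pr => e e0.
have fA := compact_finmeas hG haarh cA.
(* (1 + d) (vol A + d) is at most vol A + e *)
pose d := Num.min 1 (e / (2 + vol A)).
have vA := vol_ge0 h A.
have d0 : 0 < d by rewrite lt_min ltr01 divr_gt0//; lra.
have d1 : d <= 1 by rewrite ge_min lexx.
have de : d * (2 + vol A) <= e.
  by rewrite -ler_pdivlMr ?ge_min ?lexx ?orbT//; lra.
have [U [oU AU fU UA]] := outer_regular haarh fA d0.
have [K [cK K1 AKU]] := compact_sub_setmul lcG cA oU AU.
have fK := compact_finmeas hG haarh cK.
have vK : 0 < vol K by exact: nbhs1_vol_gt0.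
have [|O [oO KO fO OK]] := outer_regular haarh fK (_ : 0 < d * vol K).
  by rewrite mulr_gt0.
have cB : compact (setmul A K) by exact: compact_setmul.
have NN : nbhs (1%g : G) (setinv [set n : G | forall k, K k -> O (k * n)%g]).
  have := @invg_continuous G 1%g [set n : G | forall k, K k -> O (k * n)%g].
  by rewrite /= invg1; apply; exact: compact_sub_near.
have [n [x [F [mF tF FB Fx]]]] := compact_pieces cB NN.
have fF j : (j < n)%N -> finmeas (F j).
  move=> jn; apply: (sub_compact_finmeas hG haarh (mF j) _ cB).
  by rewrite -FB; exact: bigcup_sup.
have step : vol K * vol (setinv A) <=
    \sum_(j < n) vol (F j) * vol (rtranslate O (x j)^-1%g).
  apply: vol_step_le => //.
  - exact/(compact_finmeas hG haarh)/compact_setinv.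
  - exact: vol_ge0.
  - by move=> j; exact: vol_ge0.
  - by move=> j; exact: finmeas_rtranslate.
  - move=> y Ay; have yAK : ltranslate y^-1%g K `<=` setmul A K.
      by move=> _ [k Kk <-]; exists y^-1%g => //; exists k.
    rewrite -(vol_ltranslate haarh y^-1%g); last by case: fK.
    have yKE : ltranslate y^-1%g K =
        \bigcup_(j in `I_n) (F j `&` ltranslate y^-1%g K).
      by rewrite -setI_bigcupl FB; apply/esym/setIidPr.
    have fK' : finmeas (ltranslate y^-1%g K) by exact: finmeas_ltranslate.
    rewrite yKE vol_fbigcup//; last first.
    + move=> j jn; apply: (finmeas_sub _ (@subIsetr _ _ _) fK').
      by apply: measurableI; [exact: mF|case: fK'].
    + by move=> i j Ii Ij [z [[Fi _] [Fj _]]]; apply: (tF i j) => //; exists z.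
    rewrite -fsbig_ord; apply: ler_sum => j _.
    have [->|/set0P[z [Fz [k Kk kz]]]] := eqVneq (F j `&` ltranslate y^-1%g K) set0.
      by rewrite /vol measure0 mulr_ge0// vol_ge0.
    rewrite indicE mem_set.
      rewrite mulr1; apply: le_vol; [|exact: subIsetl|exact: fF].
      by apply: measurableI; [exact: mF|case: fK'].
    rewrite rtranslateE /= invgK.
    have [m Nm mz] := Fx _ (ltn_ord j) _ Fz.
    have -> : (y * x j = k * m^-1)%g.
      by apply: (@mulIg _ m); rewrite mulgVK -mulgA mz -kz mulVKg.
    exact: Nm.
have fFj j : vol (F j) * vol (rtranslate O (x j)^-1%g) = vol (F j) * vol O.
  by rewrite vol_rtranslate//; case: fO.
have vB : \sum_(j < n) vol (F j) <= vol U.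
  have -> : \sum_(j < n) vol (F j) = vol (setmul A K).
    by rewrite -FB vol_fbigcup// -fsbig_ord.
  by apply: le_vol => //; exact: (compact_borel_set hG haarh).
move: step; under eq_bigr do rewrite fFj; rewrite -mulr_suml => step.
have vO := vol_ge0 h O.
rewrite -(ler_pM2l vK); apply: (le_trans step).
apply: (@le_trans _ _ ((vol A + d) * (vol K * (1 + d)))).
  apply: ler_pM => //; first by rewrite sumr_ge0// => j _; exact: vol_ge0.
    exact: (le_trans vB (ltW UA)).
  by nra.
rewrite mulrCA ler_pM2l//; nra.
Qed.

Lemma vol_setinv_compact A : compact A -> vol (setinv A) = vol A.
Proof.
move=> cA; apply/eqP; rewrite eq_le vol_setinv_le//=.
by rewrite -{1}(setinvK A) vol_setinv_le//; exact: compact_setinv.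
Qed.

(** From compact to open sets by inner regularity, then to Borel sets by outer
    regularity. *)
Lemma le_measure_setinv A : borel_set A -> (h (setinv A) <= h A)%E.
Proof.
have [_ _ _ outer inner] := haarh.
have le_open U : open U -> (h U <= h (setinv U))%E.
  move=> oU; rewrite (inner _ oU); apply: ub_ereal_sup => _ [K [cK KU] <-].
  have cK' := compact_setinv cK.
  rewrite (volE (compact_finmeas hG haarh cK)) -vol_setinv_compact//.
  rewrite -(volE (compact_finmeas hG haarh cK')).
  apply: le_measure; rewrite ?inE.
  - exact: (compact_borel_set hG haarh cK').
  - by apply: open_borel_set; exact: open_setinv.
  - by move=> x /KU.
move=> mA; rewrite [leRHS]outer//; apply/ereal_infP => _ [U [oU AU] <-].
have oU' : open (setinv U) by exact: open_setinv.
apply: (@le_trans _ _ (h (setinv U))).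
  apply: le_measure; rewrite ?inE; [exact: borel_set_setinv| |by move=> x /AU].
  exact: open_borel_set.
by rewrite -[in leRHS](setinvK U); exact: le_open.
Qed.

Lemma vol_setinv A : borel_set A -> vol (setinv A) = vol A.
Proof.
move=> mA; congr fine; apply/eqP; rewrite eq_le le_measure_setinv//=.
by rewrite -[in leLHS](setinvK A); apply: le_measure_setinv; exact: borel_set_setinv.
Qed.

End Inversion.

(** * Convolutions of indicators *)

Section Slices.
Context {R : realType} {G : topologicalGroupType}.
Variable h : {measure set (borel G) -> \bar R}.
Implicit Types (x y z : G) (A B C D U N E : set G).
Hypothesis hG : hausdorff_space G.
Hypothesis haarh : left_haar h.
Local Notation vol := (vol h).
Local Notation finmeas := (finmeas h).

(** The part of [D] over which the convolution of the indicators of [D] and [E]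
    at [y] is an integral of the constant 1. *)
Definition slice D E y : set G := [set x | D x /\ E (x^-1 * y)%g].

Lemma borel_set_slice D E y : compact D -> loc_measurable h E ->
  borel_set (slice D E y).
Proof.
move=> cD mE; pose F := setmul (setinv D) [set y].
have cF : compact F.
  by apply: compact_setmul; [exact: compact_setinv|exact: compact_set1].
have [mF Foo] := compact_finmeas hG haarh cF.
have -> : slice D E y = D `&` (fun x => x^-1 * y)%g @^-1` (E `&` F).
  apply/seteqP; split => x /= [Dx Exy]; last by case: Exy.
  split => //; split => //; exists x^-1%g; first by rewrite /setinv /= invgK.
  by exists y.
apply: measurableI; first exact: (compact_borel_set hG haarh).
apply: borel_set_preimage; last exact: mE.
move=> x; apply: (@continuous_comp _ _ _ (fun x => x^-1)%g (fun x => x * y)%g).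
  exact: invg_continuous.
exact: rmul_continuous.
Qed.

Lemma finmeas_slice D E y : compact D -> loc_measurable h E ->
  finmeas (slice D E y).
Proof.
move=> cD mE; apply: (sub_compact_finmeas hG haarh) (borel_set_slice _ cD mE) _ cD.
by move=> x [].
Qed.

Lemma vol_slice_le D E y : compact D -> loc_measurable h E ->
  vol (slice D E y) <= vol D.
Proof.
move=> cD mE; apply: le_vol; first exact: borel_set_slice.
  by move=> x [].
exact: compact_finmeas.
Qed.

(** An open set around [D] of nearly the same volume still contains [n D] when
    [n] is close to 1. *)
Lemma near_vol_ltranslateD D (e : R) : compact D -> 0 < e ->
  \forall n \near (1%g : G), vol (ltranslate n D `\` D) < e.
Proof.
move=> cD e0; have fD := compact_finmeas hG haarh cD; have [mD _] := fD.
have [U [oU DU fU UD]] := outer_regular haarh fD e0.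
apply: filterS (compact_sub_nearl cD oU DU) => n nDU.
have fU' : finmeas (U `\` D).
  by apply: (finmeas_sub _ (@subDsetl _ _ _) fU); apply: measurableD; case: fU.
apply: (@le_lt_trans _ _ (vol (U `\` D))).
  apply: le_vol => //.
    by apply: measurableD => //; exact: borel_set_ltranslate.
  by move=> _ [[d Dd <-] nD]; split => //; exact: nDU.
by rewrite vol_setD// ltrBlDl.
Qed.

(** Left translation by [n] maps the slice of [D] at [y] to the slice of [n D]
    at [n y]. *)
Lemma vol_slice_perturb D E y n : compact D -> loc_measurable h E ->
  vol (slice D E y) <= vol (slice D E (n * y)%g) + vol (ltranslate n D `\` D).
Proof.
move=> cD mE; have cnD := compact_ltranslate (x := n) cD.
have -> : vol (slice D E y) = vol (slice (ltranslate n D) E (n * y)%g).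
  rewrite -(vol_ltranslate haarh n); last exact: borel_set_slice.
  congr vol; apply/seteqP; split => z.
    move=> [x [Dx Ex] <-]; split; first by exists x.
    by rewrite invgM -mulgA mulKg.
  move=> [[x Dx <-] Ex]; exists x => //; split => //.
  by move: Ex; rewrite invgM -mulgA mulKg.
rewrite (vol_setUI (finmeas_slice _ cnD mE) (compact_borel_set hG haarh cD)).
apply: lerD; apply: le_vol.
- apply: measurableI; first exact: borel_set_slice.
  exact: (compact_borel_set hG haarh).
- by move=> x [[_ Ex] Dx].
- exact: finmeas_slice.
- apply: measurableD; first exact: borel_set_slice.
  exact: (compact_borel_set hG haarh).
- by move=> x [[nDx _] Dx].
- apply: (sub_compact_finmeas hG haarh _ (@subDsetl _ _ _) cnD).
  by apply: measurableD; [exact: (compact_borel_set hG haarh cnD)|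
    exact: (compact_borel_set hG haarh cD)].
Qed.

Lemma vol_slice_continuous D E : compact D -> loc_measurable h E ->
  continuous (fun y => vol (slice D E y)).
Proof.
move=> cD mE y; apply/cvgrPdist_lt => e e0.
have N1 := near_vol_ltranslateD cD e0.
have q1 : (fun z => z * y^-1)%g @ y --> (1%g : G).
  by rewrite -[X in _ --> X](mulgV y); exact: rmul_continuous.
have q2 : (fun z => y * z^-1)%g @ y --> (1%g : G).
  rewrite -[X in _ --> X](mulgV y).
  apply: (@continuous_comp _ _ _ (fun z => z^-1)%g (fun z => y * z)%g).
    exact: invg_continuous.
  exact: lmul_continuous.
near=> z; rewrite ltr_norml; apply/andP; split.
- have := vol_slice_perturb z (y * z^-1)%g cD mE; rewrite mulgVK.
  have : vol (ltranslate (y / z)%g D `\` D) < e by near: z; exact: q2 N1.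
  lra.
- have := vol_slice_perturb y (z * y^-1)%g cD mE; rewrite mulgVK.
  have : vol (ltranslate (z / y)%g D `\` D) < e by near: z; exact: q1 N1.
  lra.
Unshelve. all: by end_near. Qed.

End Slices.

(** * Means as functionals on bounded functions *)

Section BoundedFunctions.
Context {R : realType} {G : topologicalGroupType}.
Variable h : {measure set (borel G) -> \bar R}.
Implicit Types (x y z : G) (A B C D U N E : set G) (f g : G -> R).

Lemma loc_ae_all (P : set G) : (forall x, P x) -> loc_ae h P.
Proof.
move=> PT F _ _; apply: negligibleS (negligible_set0 h) => x [] /=.
by move=> nP _; apply: nP; exact: PT.
Qed.

Lemma Linfty_bounded f (c : R) : loc_measurable_fun h f ->
  (forall x, `|f x| <= c) -> f \in Linfty_pred h.
Proof.
by move=> mf fc; rewrite inE; split => //; exists c; exact: loc_ae_all.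
Qed.

Lemma Linfty_ofK f : f \in Linfty_pred h -> Linfty_of h f = f :> (G -> R).
Proof. by move=> fP; rewrite /Linfty_of insubdK. Qed.

(** It suffices to test open rays, so continuity and lower semicontinuity both
    give measurability. *)
Lemma lsc_measurable f : (forall a : R, open [set x | a < f x]) ->
  loc_measurable_fun h f.
Proof.
move=> fo F mF _; suff : measurable_fun [set: borel G] (f : borel G -> R).
  exact: measurable_funS.
apply: (measurability _ (RGenOInfty.measurableE R)).
move=> /= _ [_ [a ->]] <-; rewrite setTI; apply: open_borel_set.
by have := fo a; congr open; apply/seteqP; split => x /=; rewrite in_itv /= andbT.
Qed.

Lemma continuous_loc_measurable f : continuous f -> loc_measurable_fun h f.
Proof.
move=> cf; apply: lsc_measurable => a.
apply: (open_comp _ (@open_gt _ a)) => x _; exact: cf.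
Qed.

Lemma indic_loc_measurable E : loc_measurable h E -> loc_measurable_fun h \1_E.
Proof.
move=> mE F mF Foo.
have : measurable_fun F (\1_(E `&` F) : borel G -> R).
  by apply: measurable_indic; exact: mE.
apply: eq_measurable_fun => x xF; rewrite !indicE in_setI.
by rewrite xF andbT.
Qed.

Lemma Linfty_indic E : loc_measurable h E -> \1_E \in Linfty_pred h.
Proof.
move=> mE; apply: (@Linfty_bounded _ 1); first exact: indic_loc_measurable.
by move=> x; rewrite indicE ger0_norm// lern1 leq_b1.
Qed.

End BoundedFunctions.

Section Means.
Context {R : realType} {G : topologicalGroupType}.
Variable h : {measure set (borel G) -> \bar R}.
Implicit Types (x y z : G) (A B C D U N E : set G) (f g : G -> R).
Hypothesis hG : hausdorff_space G.
Hypothesis lcG : locally_compact [set: G].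
Hypothesis haarh : left_haar h.
Variable mu : Linfty h -> R.
Hypothesis mu_mean : means h mu.

(** Working with plain functions avoids carrying proofs of essential
    boundedness; all uses are for functions in [Linfty_pred]. *)
Definition mean_fun f : R := mu (Linfty_of h f).
Local Notation M := mean_fun.

Lemma mean_fun_lin (a : R) f g : f \in Linfty_pred h -> g \in Linfty_pred h ->
  M (fun x => a * f x + g x) = a * M f + M g.
Proof.
move=> fP gP; have [smu _ _] := mu_mean; rewrite /M -smu; congr mu.
have fgP : (fun x => a * f x + g x) \in Linfty_pred h.
  rewrite -[_ \in _]/(a *: f + g \in Linfty_pred h).
  by apply: rpredD => //; exact: rpredZ.
apply: val_inj => /=; rewrite Linfty_ofK//.
by apply/funext => x /=; rewrite /= !Linfty_ofK.
Qed.

Lemma mean_fun_ge0 f : f \in Linfty_pred h -> (forall x, 0 <= f x) -> 0 <= M f.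
Proof.
move=> fP f0; have [_ _ pmu] := mu_mean; apply: pmu.
by apply: loc_ae_all => x /=; rewrite Linfty_ofK.
Qed.

Lemma LinftyB f g : f \in Linfty_pred h -> g \in Linfty_pred h ->
  (fun x => f x - g x) \in Linfty_pred h.
Proof. by move=> fP gP; exact: rpredB. Qed.

Lemma LinftyD f g : f \in Linfty_pred h -> g \in Linfty_pred h ->
  (fun x => f x + g x) \in Linfty_pred h.
Proof. by move=> fP gP; exact: rpredD. Qed.

Lemma LinftyZ (a : R) f : f \in Linfty_pred h ->
  (fun x => a * f x) \in Linfty_pred h.
Proof. by move=> fP; exact: rpredZ. Qed.

Lemma Linfty_cst (a : R) : (fun=> a) \in Linfty_pred h.
Proof.
by apply: (@Linfty_bounded _ _ _ _ `|a|) => // F _ _; exact: measurable_cst.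
Qed.

Lemma mean_funB f g : f \in Linfty_pred h -> g \in Linfty_pred h ->
  M (fun x => f x - g x) = M f - M g.
Proof.
move=> fP gP; have := mean_fun_lin (-1) gP fP; rewrite mulN1r addrC => <-.
by congr M; apply/funext => x; rewrite mulN1r addrC.
Qed.

Lemma mean_funD f g : f \in Linfty_pred h -> g \in Linfty_pred h ->
  M (fun x => f x + g x) = M f + M g.
Proof.
move=> fP gP; have := mean_fun_lin 1 fP gP; rewrite mul1r => <-.
by congr M; apply/funext => x; rewrite mul1r.
Qed.

Lemma mean_fun0 : M (fun=> 0) = 0.
Proof.
transitivity (M (fun=> 0 - 0)); first by rewrite subrr.
by rewrite (mean_funB (Linfty_cst 0) (Linfty_cst 0)) subrr.
Qed.

Lemma mean_funZ (a : R) f : f \in Linfty_pred h -> M (fun x => a * f x) = a * M f.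
Proof.
move=> fP; have := mean_fun_lin a fP (Linfty_cst 0); rewrite mean_fun0 addr0 => <-.
by congr M; apply/funext => x; rewrite addr0.
Qed.

Lemma Linfty_sum (I : Type) (s : seq I) (F : I -> G -> R) :
  (forall i, F i \in Linfty_pred h) ->
  (fun x => \sum_(i <- s) F i x) \in Linfty_pred h.
Proof.
move=> FP; elim: s => [|i s IH].
  by under eq_fun do rewrite big_nil; exact: Linfty_cst.
by under eq_fun do rewrite big_cons; exact: LinftyD.
Qed.

Lemma mean_fun_sum (I : Type) (s : seq I) (F : I -> G -> R) :
  (forall i, F i \in Linfty_pred h) ->
  M (fun x => \sum_(i <- s) F i x) = \sum_(i <- s) M (F i).
Proof.
move=> FP; elim: s => [|i s IH].
  by under eq_fun do rewrite big_nil; rewrite big_nil mean_fun0.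
under eq_fun do rewrite big_cons; rewrite big_cons -IH.
by rewrite mean_funD//; exact: Linfty_sum.
Qed.

Lemma le_mean_fun f g : f \in Linfty_pred h -> g \in Linfty_pred h ->
  (forall x, f x <= g x) -> M f <= M g.
Proof.
move=> fP gP fg; rewrite -subr_ge0 -mean_funB//; apply: mean_fun_ge0.
  exact: LinftyB.
by move=> x; rewrite subr_ge0.
Qed.

(** Used to see that a bound for an absolute value that holds locally almost
    everywhere is nonnegative, so that the infimum in [Linfty_norm] is over a set
    that is bounded below. *)
Lemma loc_ae_compact (P : set G) (C : set G) : loc_ae h P -> compact C ->
  0 < vol h C -> exists2 x, C x & P x.
Proof.
move=> aeP cC C0; have [mC Coo] := compact_finmeas hG haarh cC.
have [|CP] := pselect (exists2 x, C x & P x); first by [].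
have : h.-negligible C.
  apply: negligibleS (aeP C mC Coo) => x Cx; split => // Px.
  by apply: CP; exists x.
move/(negligibleP h mC) => hC.
by move: C0; rewrite /vol hC ltxx.
Qed.

Lemma compact_vol_gt0 : exists2 C : set G, compact C & 0 < vol h C.
Proof.
have [K [cK K1 _]] := compact_nbhs1 lcG (@filterT _ (nbhs (1%g : G)) _).
by exists K => //; exact: (nbhs1_vol_gt0 hG haarh).
Qed.

Lemma Linfty_norm_ae (phi : Linfty h) (e : R) : 0 < e ->
  Linfty_norm phi <= 1 -> loc_ae h [set x | `|phi x| <= 1 + e].
Proof.
move=> e0 phi1; set S := [set c : R | loc_ae h [set x | `|phi x| <= c]].
have S0 : has_inf S.
  split; first by have := LinftyP phi; rewrite inE => -[].
  exists 0 => c Sc; have [C cC C0] := compact_vol_gt0.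
  have [x _ /=] := loc_ae_compact Sc cC C0; exact: le_trans.
have [c Sc] := inf_adherent e0 S0.
rewrite -/(Linfty_norm phi) => ce F mF Foo.
apply: negligibleS (Sc F mF Foo) => x [/= n1 Fx]; split => // le1; apply: n1.
by apply: le_trans le1 _; lra.
Qed.

(** If [phi] has norm at most 1, positivity bounds [mu phi] in absolute value by
    [(1 + d) * mu 1] for all [d > 0], so the dual norm of [mu] is [mu 1]. *)
Lemma mean_fun1 : M (fun=> 1) = 1.
Proof.
have [smu nmu pmu] := mu_mean.
have M1_ge0 : 0 <= M (fun=> 1) by apply: mean_fun_ge0; [exact: Linfty_cst|].
have muE phi : mu phi = M phi.
  congr mu; apply: val_inj => /=; rewrite Linfty_ofK//; exact: LinftyP.
apply/eqP; rewrite eq_le; apply/andP; split.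
  rewrite -lee_fin -nmu -(ger0_norm M1_ge0); apply: ereal_sup_ubound.
  exists (Linfty_of h (fun=> 1)) => //=.
  apply: ge_inf; last first.
    by apply: loc_ae_all => x /=; rewrite Linfty_ofK ?normr1//; exact: Linfty_cst.
  exists 0 => c Sc; have [C cC C0] := compact_vol_gt0.
  have [x _ /=] := loc_ae_compact Sc cC C0; exact: le_trans.
apply/ler_addgt0Pr => e e0.
rewrite -lee_fin -nmu; apply: ub_ereal_sup => _ [phi phi1 <-]; rewrite lee_fin.
pose d := e / (M (fun=> 1) + 1).
have d0 : 0 < d by rewrite divr_gt0//; lra.
have phid := Linfty_norm_ae d0 phi1.
have phiP := LinftyP phi.
have bound (s : R) : `|s| = 1 -> s * mu phi <= M (fun=> 1) + e.
  move=> s1; rewrite muE -mean_funZ//.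
  have : 0 <= mu (Linfty_of h (fun x => (1 + d) * 1 - s * phi x)).
    apply: pmu => F mF Foo; apply: negligibleS (phid F mF Foo) => x [/= n Fx].
    split => // le1; apply: n; rewrite Linfty_ofK.
      rewrite mulr1 subr_ge0; apply: le_trans le1.
      by rewrite -[leRHS]mul1r -s1 -normrM ler_norm.
    by apply: LinftyB; [apply: LinftyZ; exact: Linfty_cst|exact: LinftyZ].
  rewrite -/(M _) mean_funB; [|by apply: LinftyZ; exact: Linfty_cst|exact: LinftyZ].
  rewrite (mean_funZ (1 + d) (Linfty_cst 1)) subr_ge0 => /le_trans; apply.
  rewrite mulrDl mul1r lerD2l /d mulrAC ler_pdivrMr; last by lra.
  by rewrite ler_pM2l//; lra.
have [s0|s0] := leP 0 (mu phi).
  by rewrite ger0_norm// -[leLHS]mul1r; apply: bound; rewrite normr1.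
by rewrite ltr0_norm// -mulN1r; apply: bound; rewrite normrN1.
Qed.

End Means.

(** * Locally finite sums of indicators and their convolutions *)

Section LocallyFiniteSums.
Context {R : realType} {G : topologicalGroupType}.
Variable h : {measure set (borel G) -> \bar R}.
Implicit Types (x y z : G) (A B C D U N : set G) (f g : G -> R).
Hypothesis hG : hausdorff_space G.
Hypothesis lcG : locally_compact [set: G].
Hypothesis haarh : left_haar h.
Context {I : choiceType}.
Implicit Types (J : set I) (c : I -> R) (E : I -> set G).
Local Notation vol := (vol h).

Definition lfsum J c E : G -> R := fun y => \sum_(i \in J) c i * \1_(E i) y.

Definition locally_finite J E : Prop := forall Q : set G, compact Q ->
  finite_set [set i | J i /\ E i `&` Q !=set0].

(** The convolution of the uniform density on [D] with [lfsum J c E], computed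
    term by term; see [conv_lfsumE]. *)
Definition conv_lfsum D J c E : G -> R :=
  fun y => (vol D)^-1 * \sum_(i \in J) c i * vol (slice D (E i) y).

Lemma slice_support D (A : set G) y : vol (slice D A y) != 0 ->
  A `&` setmul (setinv D) [set y] !=set0.
Proof.
move=> v0; apply/set0P; apply: contraNN v0 => /eqP A0.
rewrite (_ : slice D A y = set0) ?/vol ?measure0//.
apply/seteqP; split => // x [Dx Ax].
suff : (A `&` setmul (setinv D) [set y]) (x^-1 * y)%g by rewrite A0.
split => //; exists x^-1%g; first by rewrite /setinv /= invgK.
by exists y.
Qed.

Lemma lfsum_seq J c E Q y : locally_finite J E -> compact Q -> Q y ->
  lfsum J c E y =
  \sum_(i <- finmap.enum_fset (fset_set [set i | J i /\ E i `&` Q !=set0]))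
     c i * \1_(E i) y.
Proof.
move=> lf cQ Qy; rewrite -fsbig_finite//; last exact: lf.
apply/esym/fsbig_widen => [i []//|i [/= Ji nQ]].
rewrite /= indicE memNset ?mulr0// => Eiy; apply: nQ; split => //.
by exists y.
Qed.

Lemma conv_lfsum_seq D J c E Q y : locally_finite J E -> compact Q ->
    setmul (setinv D) [set y] `<=` Q ->
  conv_lfsum D J c E y = (vol D)^-1 *
  \sum_(i <- finmap.enum_fset (fset_set [set i | J i /\ E i `&` Q !=set0]))
     c i * vol (slice D (E i) y).
Proof.
move=> lf cQ DyQ; rewrite -fsbig_finite//; last exact: lf.
congr (_ * _); apply/esym/fsbig_widen => [i []//|i [/= Ji nQ]].
apply/eqP; rewrite mulf_eq0; apply/orP; right; apply: contraPT nQ.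
by move=> /slice_support[z [Ez /DyQ Qz]] /(_ _); apply; split => //; exists z.
Qed.

Lemma conv_lfsumE D J c E y : compact D -> 0 < vol D ->
  (forall i, 0 <= c i) -> (forall i, loc_measurable h (E i)) ->
  locally_finite J E ->
  convolution h (fun x => \1_D x / vol D) (lfsum J c E) y = conv_lfsum D J c E y.
Proof.
move=> cD D0 c0 mE lf.
have cQ : compact (setmul (setinv D) [set y]).
  by apply: compact_setmul; [exact: compact_setinv|exact: compact_set1].
rewrite (conv_lfsum_seq c lf cQ)// mulr_sumr.
under eq_bigr do rewrite mulrA.
rewrite -Rintegral_step; last 2 first.
- by move=> i; rewrite mulr_ge0// invr_ge0 ltW.
- by move=> i; exact: (finmeas_slice hG haarh).
apply: eq_Rintegral => x _; rewrite /ltrans.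
case: (asboolP (D x)) => Dx; last first.
  rewrite indicE memNset// !mul0r big1// => i _.
  by rewrite indicE memNset ?mulr0// => -[].
rewrite indicE mem_set// mul1r (lfsum_seq c lf cQ); last first.
  by exists x^-1%g; [rewrite /setinv /= invgK|exists y].
rewrite mulr_sumr; apply: eq_bigr => i _; rewrite mulrA; congr (_ * _).
rewrite !indicE; congr (_ : bool)%:R.
by apply/idP/idP; rewrite !inE; [split|case].
Qed.

Lemma continuous_sumr (K : Type) (s : seq K) (F : K -> G -> R) :
  (forall k, continuous (F k)) -> continuous (fun x => \sum_(k <- s) F k x).
Proof.
move=> cF; elim: s => [|k s IH] x.
  by under eq_fun do rewrite big_nil; exact: cvg_cst.
by under eq_fun do rewrite big_cons; apply: cvgD; [exact: cF|exact: IH].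
Qed.

(** Near a given point only finitely many terms matter, and each is continuous;
    this is what makes the convolution measurable. *)
Lemma conv_lfsum_continuous D J c E : compact D ->
  (forall i, loc_measurable h (E i)) -> locally_finite J E ->
  continuous (conv_lfsum D J c E).
Proof.
move=> cD mE lf y.
have [K + [cK clK]] := @lcG y Logic.I; rewrite withinET => Ky.
have cQ : compact (setmul (setinv D) K).
  by apply: compact_setmul => //; exact: compact_setinv.
pose s := finmap.enum_fset (fset_set
  [set i | J i /\ E i `&` setmul (setinv D) K !=set0]).
pose F z := (vol D)^-1 * \sum_(i <- s) c i * vol (slice D (E i) z).
have FE z : K z -> conv_lfsum D J c E z = F z.
  move=> Kz; apply: (conv_lfsum_seq c lf cQ) => _ [d Dd [_ -> <-]].
  by exists d => //; exists z.
have cF : continuous F.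
  move=> z; apply: cvgM; first exact: cvg_cst.
  apply: continuous_sumr => i w; apply: cvgM; first exact: cvg_cst.
  exact: (vol_slice_continuous hG haarh cD (mE i)).
rewrite /continuous_at (FE _ (nbhs_singleton Ky)).
apply: cvg_trans (cF y); apply: near_eq_cvg.
by apply: filterS Ky => z /FE.
Qed.

Lemma conv_lfsum_ge0 D J c E y : (forall i, 0 <= c i) -> 0 <= conv_lfsum D J c E y.
Proof.
move=> c0; rewrite mulr_ge0// ?invr_ge0 ?vol_ge0// fsumr_ge0// => i _.
by rewrite mulr_ge0// vol_ge0.
Qed.

Lemma conv_lfsum_le D J c E (b : R) y : compact D -> 0 < vol D ->
  (forall i, 0 <= c i) -> (forall i, loc_measurable h (E i)) ->
  locally_finite J E -> (forall x, lfsum J c E x <= b) ->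
  conv_lfsum D J c E y <= b.
Proof.
move=> cD D0 c0 mE lf cb.
have cQ : compact (setmul (setinv D) [set y]).
  by apply: compact_setmul; [exact: compact_setinv|exact: compact_set1].
rewrite (conv_lfsum_seq c lf cQ)// ler_pdivrMl// mulrC.
have b0 : 0 <= b.
  by apply: le_trans (cb y); rewrite fsumr_ge0// => i _; rewrite mulr_ge0.
have := @step_le _ _ h I unit _ [:: tt] c (fun=> b)
  (fun i => slice D (E i) y) (fun=> D) c0.
rewrite big_seq1; apply => //.
- by move=> i; exact: (finmeas_slice hG haarh).
- by move=> _; exact: (compact_finmeas hG haarh).
move=> x; rewrite big_seq1.
case: (asboolP (D x)) => Dx; last first.
  rewrite [\1_D _]indicE memNset// mulr0 big1// => i _.
  by rewrite indicE memNset ?mulr0// => -[].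
rewrite [\1_D _]indicE mem_set// mulr1; apply: le_trans (cb (x^-1 * y)%g).
rewrite (lfsum_seq c lf cQ); last first.
  by exists x^-1%g; [rewrite /setinv /= invgK|exists y].
apply: ler_sum => i _; rewrite ler_wpM2l// !indicE ler_nat.
by case: (boolP (x \in _)) => //=; rewrite inE => -[_ Ex]; rewrite mem_set.
Qed.

Lemma lfsum_ge0 J c E x : (forall i, 0 <= c i) -> 0 <= lfsum J c E x.
Proof. by move=> c0; rewrite fsumr_ge0// => i _; rewrite mulr_ge0. Qed.

Lemma conv_lfsum_Linfty D J c E (b : R) : compact D -> 0 < vol D ->
  (forall i, 0 <= c i) -> (forall i, loc_measurable h (E i)) ->
  locally_finite J E -> (forall x, lfsum J c E x <= b) ->
  conv_lfsum D J c E \in Linfty_pred h.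
Proof.
move=> cD D0 c0 mE lf cb; apply: (@Linfty_bounded _ _ _ _ b).
  by apply: continuous_loc_measurable; exact: conv_lfsum_continuous.
by move=> x; rewrite ger0_norm ?conv_lfsum_ge0//; exact: conv_lfsum_le.
Qed.

Lemma uniform_M1 D : compact D -> 0 < vol D ->
  M1 h (fun x => \1_D x / vol D).
Proof.
move=> cD D0; have fD := compact_finmeas hG haarh cD; have [mD Doo] := fD.
have pos x : 0 <= \1_D x / vol D :> R by rewrite divr_ge0// vol_ge0.
have int : (\int[h]_(x in [set: borel G]) (\1_D x / vol D)%:E = 1)%E.
  have := @integral_step _ _ h unit [:: tt] (fun=> (vol D)^-1) (fun=> D).
  rewrite big_seq1 mulVf ?gt_eqF// => <- //; last by move=> _; rewrite invr_ge0 ltW.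
  by apply: eq_integral => x _; rewrite big_seq1 mulrC.
split.
- apply/Lfun1_integrable/integrableP; split.
    by apply/measurable_EFinP; apply: measurable_funM.
  under eq_integral => x _ do rewrite /= ger0_norm//.
  by rewrite int ltry.
- rewrite Lnorm1; under eq_integral => x _ do rewrite /= ger0_norm//.
  exact: int.
- exact: aeW.
Qed.

(** The form in which the invariance of [mu] is used below. *)
Lemma TLIM_lfsum (mu : Linfty h -> R) D J c E : TLIM h mu ->
  compact D -> 0 < vol D ->
  (forall i, 0 <= c i) -> (forall i, loc_measurable h (E i)) ->
  locally_finite J E -> lfsum J c E \in Linfty_pred h ->
  mean_fun mu (lfsum J c E) = mean_fun mu (conv_lfsum D J c E).
Proof.
move=> [_ inv] cD D0 c0 mE lf fP.
rewrite /mean_fun (inv _ _ (uniform_M1 cD D0)) (Linfty_ofK fP).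
by congr (mu (Linfty_of _ _)); apply/funext => y; exact: conv_lfsumE.
Qed.

(** Lower semicontinuity: near a point, all the finitely many open sets that
    contain it are still hit. *)
Lemma lfsum_open_Linfty J c E (b : R) : (forall i, 0 <= c i) ->
  (forall i, open (E i)) -> locally_finite J E ->
  (forall x, lfsum J c E x <= b) -> lfsum J c E \in Linfty_pred h.
Proof.
move=> c0 oE lf cb; apply: (@Linfty_bounded _ _ _ _ b); last first.
  by move=> x; rewrite ger0_norm ?cb// lfsum_ge0.
apply: lsc_measurable => a; rewrite openE => y /= ay.
have [K + [cK clK]] := @lcG y Logic.I; rewrite withinET => Ky.
pose s := finmap.enum_fset (fset_set [set i | J i /\ E i `&` K !=set0]).
have lfE z : K z -> lfsum J c E z = \sum_(i <- s) c i * \1_(E i) z.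
  by move=> Kz; exact: lfsum_seq.
have : \forall z \near y, \sum_(i <- s) c i * \1_(E i) y <=
                          \sum_(i <- s) c i * \1_(E i) z.
  elim: s {lfE} => [|i s IH].
    by apply: nearW => z; rewrite !big_nil.
  have : \forall z \near y, \1_(E i) y <= \1_(E i) z :> R.
    have [Ey|Ey] := pselect (E i y).
      have : nbhs y (E i) by apply: open_nbhs_nbhs.
      by apply: filterS => z Ez; rewrite !indicE !mem_set.
    by apply: nearW => z; rewrite indicE memNset.
  apply: filterS2 IH => z sz iz; rewrite !big_cons lerD// ler_wpM2l//.
have Ky0 := nbhs_singleton Ky.
by apply: filterS2 Ky => z Kz; rewrite -!lfE//; apply: lt_le_trans.
Qed.

End LocallyFiniteSums.

(** * The Hahn-Banach theorem *)

Section HahnBanach.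
Context {R : realType} {V : lmodType R}.
Implicit Types (p q : V -> R) (x y z : V).

Definition sublinear p : Prop :=
  (forall x y, p (x + y) <= p x + p y) /\
  (forall (t : R) x, 0 <= t -> p (t *: x) = t * p x).

Lemma sublinear0 p : sublinear p -> p 0 = 0.
Proof. by move=> [_ hp]; rewrite -(scale0r 0) hp// mul0r. Qed.

Lemma sublinear_geN p x : sublinear p -> - p (- x) <= p x.
Proof.
move=> sp; have [ap _] := sp.
by have := ap x (- x); rewrite subrr (sublinear0 sp); lra.
Qed.

(** Shared by the three infima formed below: over a chain of functionals, along
    a ray and over a cone. *)
Lemma inf_sublinear (S : V -> set R) :
  (forall x, has_inf (S x)) -> S 0 `<=` [set r | 0 <= r] ->
  (forall x y a b, S x a -> S y b -> exists2 c, S (x + y) c & c <= a + b) ->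
  (forall (t : R) x a, 0 < t -> S x a -> S (t *: x) (t * a)) ->
  sublinear (fun x => inf (S x)).
Proof.
move=> iS S0 SD SZ.
have le_inf x a : S x a -> inf (S x) <= a.
  by move=> Sa; apply: ge_inf => //; case: (iS x).
have inf_le x a : (forall b, S x b -> a <= b) -> a <= inf (S x).
  by move=> Sa; apply: lb_le_inf => //; case: (iS x).
have infZ (t : R) x : 0 < t -> t * inf (S x) <= inf (S (t *: x)).
  move=> t0; apply: inf_le => b Sb; rewrite mulrC -ler_pdivlMr//; apply: le_inf.
  have := SZ t^-1 _ _ _ Sb; rewrite scalerA mulVf ?gt_eqF// scale1r mulrC; apply.
  by rewrite invr_gt0.
split=> [x y|t x].
  rewrite -lerBlDr; apply: (inf_le) => a Sa; rewrite lerBlDr -lerBlDl.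
  apply: inf_le => b Sb; rewrite lerBlDl; have [c Sc] := SD _ _ _ _ Sa Sb.
  by apply: le_trans; exact: le_inf.
rewrite le_eqVlt => /predU1P[<-|t0].
  rewrite scale0r mul0r; apply/eqP; rewrite eq_le; apply/andP; split.
    apply/ler_addgt0Pr => e e0; rewrite add0r.
    have [a Sa ae] := inf_adherent ltr01 (iS 0).
    have a0 := S0 _ Sa.
    have a1 : 0 < a + 1 by rewrite ltr_wpDl.
    apply: (@le_trans _ _ (e / (a + 1) * a)).
      apply: le_inf; rewrite -(scaler0 _ (e / (a + 1))); apply: SZ => //.
      exact: divr_gt0.
    by rewrite mulrAC ler_pdivrMr// ler_pM2l// lerDl.
  by apply: inf_le => b /S0.
apply/eqP; rewrite eq_le infZ// andbT.
have := infZ t^-1 (t *: x); rewrite scalerA mulVf ?gt_eqF// scale1r => /(_ _).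
by rewrite mulrC ler_pdivrMr ?invr_gt0// mulrC; apply.
Qed.

(** In a chain of sublinear functionals below [p] all values at [x] are at least
    [- p (- x)], so that the infimum of the chain is finite. *)
Lemma sublinear_minimal p : sublinear p -> exists q, [/\ sublinear q,
  forall x, q x <= p x &
  forall r, sublinear r -> (forall x, r x <= q x) -> r = q].
Proof.
move=> sp.
pose P q := sublinear q /\ forall x, q x <= p x.
pose below (q r : {q | P q}) : bool := `[< forall x, sval r x <= sval q x >].
have val_injP (q r : {q | P q}) : sval q = sval r -> q = r.
  case: q r => [q qP] [r rP] /= qr; move: qP rP; rewrite qr => qP rP.
  by congr exist; exact: Prop_irrelevance.
have [||||[q [sq qp]] minq] := @Zorn {q | P q} below.
- by move=> q; apply/asboolP.
- move=> q r s /asboolP qr /asboolP rs; apply/asboolP => x.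
  exact: le_trans (qr x).
- move=> q r /asboolP qr /asboolP rq; apply: val_injP; apply/funext => x.
  by apply/eqP; rewrite eq_le rq qr.
- move=> A tA; have [[q0 Aq0]|A0] := pselect (exists k, A k); last first.
    exists (exist _ p (conj sp (fun x => lexx (p x)))) => s As.
    by exfalso; apply: A0; exists s.
  pose S x := [set sval k x | k in A].
  have lbS x : lbound (S x) (- p (- x)).
    move=> _ [[q [sq qp]] Aq <-] /=; apply: le_trans (sublinear_geN _ sq).
    by rewrite lerN2.
  have iS x : has_inf (S x).
    by split; [exists (sval q0 x), q0|exists (- p (- x))].
  have sS : sublinear (fun x => inf (S x)).
    apply: inf_sublinear => //.
    - by move=> _ [[q [sq qp]] Aq <-] /=; rewrite (sublinear0 sq).
    - move=> x y _ _ [q Aq <-] [r Ar <-].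
      have [/asboolP qr|/asboolP rq] := tA _ _ Aq Ar.
        exists (sval r (x + y)); first by exists r.
        by apply: le_trans (lerD (qr x) (lexx _)); case: (svalP r) => -[].
      exists (sval q (x + y)); first by exists q.
      by apply: le_trans (lerD (lexx _) (rq y)); case: (svalP q) => -[].
    - move=> t x _ t0 [q Aq <-]; exists q => //.
      by case: (svalP q) => -[_ ->//]; exact: ltW.
  have leS x k : A k -> inf (S x) <= sval k x.
    by move=> Ak; apply: ge_inf; [case: (iS x)|exists k].
  have PS : P (fun x => inf (S x)).
    split => // x; apply: le_trans (leS _ _ Aq0) _; case: (svalP q0) => _; exact.
  by exists (exist _ _ PS) => s As; apply/asboolP => x; exact: leS.
- exists q; split => // r sr rq.
  have Pr : P r by split => // x; exact: le_trans (qp x).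
  have := minq (exist _ r Pr) (_ : below _ _) => /(_ _)/(congr1 sval); apply.
  exact/asboolP.
Qed.

(** A minimal sublinear functional is linear: lowering it along the ray of a
    vector [y] gives a sublinear functional that cannot be strictly smaller. *)
Lemma sublinear_dominates_linear p : sublinear p ->
  exists L : V -> R, scalar L /\ forall x, L x <= p x.
Proof.
move=> /sublinear_minimal[q [sq qp minq]]; exists q; split => //.
have [subq homq] := sq.
have superadd x y : q x + q y <= q (x + y).
  pose S x := [set q (x + t *: y) - t * q y | t in [set t : R | 0 <= t]].
  have lbS z : lbound (S z) (- q (- z)).
    move=> _ [t /= t0 <-]; rewrite -homq// lerBrDl lerBlDr.
    by have := subq (z + t *: y) (- z); rewrite addrAC subrr add0r.
  have iS z : has_inf (S z).
    by split; [exists (q (z + 0 *: y) - 0 * q y), 0 => /=|exists (- q (- z))].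
  have leS z t : 0 <= t -> inf (S z) <= q (z + t *: y) - t * q y.
    by move=> t0; apply: ge_inf; [case: (iS z)|exists t].
  have sS : sublinear (fun z => inf (S z)).
    apply: inf_sublinear => //.
    - by move=> _ [t /= t0 <-]; rewrite add0r homq// subrr.
    - move=> z w _ _ [t /= t0 <-] [u /= u0 <-].
      exists (q ((z + w) + (t + u) *: y) - (t + u) * q y).
        by exists (t + u) => //=; exact: addr_ge0.
      rewrite addrACA -opprD -mulrDl lerD2r scalerDl addrACA; exact: subq.
    - move=> t z _ t0 [u /= u0 <-]; exists (t * u) => /=.
        by rewrite mulr_ge0// ltW.
      by rewrite -scalerA -scalerDr homq ?(ltW t0)// mulrBr mulrA.
  have Sq z : inf (S z) <= q z.
    by have := leS z 0 (lexx _); rewrite scale0r addr0 mul0r subr0.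
  have qE : q x = inf (S x) by rewrite -[LHS]/(q x) -[in LHS](minq _ sS Sq).
  by have := leS x 1 ler01; rewrite -qE scale1r mul1r lerBrDr.
have addq x y : q (x + y) = q x + q y.
  by apply/eqP; rewrite eq_le subq superadd.
have oppq x : q (- x) = - q x.
  by apply/eqP; rewrite -addr_eq0 -addq addNr (sublinear0 sq).
move=> a x y; rewrite addq; congr (_ + _).
have [a0|a0] := leP 0 a; first exact: homq.
by rewrite -[a]opprK scaleNr oppq homq ?mulNr// oppr_ge0 ltW.
Qed.

(** A linear form is as required if it lies below the largest sublinear
    functional below [p] that is at most [- v.2] at [- v.1] for all [v] in the
    cone. This functional is an infimum over the cone. *)
Lemma hahn_banach_cone p (C : set (V * R)) : sublinear p -> C (0, 0) ->
  (forall v w, C v -> C w -> C (v.1 + w.1, v.2 + w.2)) ->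
  (forall (t : R) v, 0 < t -> C v -> C (t *: v.1, t * v.2)) ->
  (forall v, C v -> v.2 <= p v.1) ->
  exists L : V -> R, [/\ scalar L, forall x, L x <= p x &
    forall v, C v -> v.2 <= L v.1].
Proof.
move=> sp C0 CD CZ Cp; have [ap hp] := sp.
pose S x := [set p (x + v.1) - v.2 | v in C].
have iS x : has_inf (S x).
  split; first by exists (p (x + (0, 0 : R).1) - (0 : V, 0).2), (0, 0).
  exists (- p (- x)) => _ [v Cv <-]; rewrite lerBrDl lerBlDr.
  apply: le_trans (Cp _ Cv) _.
  by have := ap (x + v.1) (- x); rewrite addrAC subrr add0r.
have [|L [sL LS]] := @sublinear_dominates_linear (fun x => inf (S x)).
  apply: inf_sublinear => //.
  - by move=> _ [v Cv <-]; rewrite /= add0r subr_ge0; exact: Cp.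
  - move=> x y _ _ [v Cv <-] [w Cw <-].
    exists (p ((x + y) + (v.1 + w.1)) - (v.2 + w.2)).
      by exists (v.1 + w.1, v.2 + w.2) => //; exact: CD.
    by rewrite opprD addrACA [leRHS]addrACA lerD2r; exact: ap.
  - move=> t x _ t0 [v Cv <-]; exists (t *: v.1, t * v.2); first exact: CZ.
    by rewrite -scalerDr hp ?(ltW t0)// mulrBr.
have leS x v : C v -> L x <= p (x + v.1) - v.2.
  by move=> Cv; apply: le_trans (LS x) _; apply: ge_inf; [case: (iS x)|exists v].
exists L; split => // [x|v Cv].
  by have := leS x _ C0; rewrite addr0 subr0.
have L0 : L 0 = 0.
  by have := sL 1 0 0; rewrite scale1r addr0 mul1r; lra.
have := leS (- v.1) _ Cv; rewrite addNr (sublinear0 sp) sub0r.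
have := sL (-1) v.1 0; rewrite L0 !addr0 scaleN1r mulN1r => ->.
by rewrite lerN2.
Qed.

End HahnBanach.

(** * Flows on expanding graphs *)

Section FiniteSupport.
Context {R : realType} {T : choiceType}.

Definition finsupp_pred : {pred T -> R} := mem [set f | finite_set [set x | f x != 0]].

Lemma finsupp_submod_closed : submod_closed finsupp_pred.
Proof.
split.
  rewrite inE /=; have -> : [set x | (0 : T -> R) x != 0] = set0.
    by apply/seteqP; split => x //=; rewrite eqxx.
  exact: finite_set0.
move=> a f g; rewrite !inE => /= ff fg.
have : finite_set ([set x | f x != 0] `|` [set x | g x != 0]) by rewrite finite_setU.
apply: sub_finite_set => x /=; rewrite -[(a *: f + g) x]/(a * f x + g x).
have [->|fx _] := eqVneq (f x) 0; last by left.
by rewrite mulr0 add0r; right.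
Qed.

HB.instance Definition _ :=
  GRing.isSubmodClosed.Build R (T -> R) finsupp_pred finsupp_submod_closed.

(** The space of finitely supported functions, on which a linear form is the
    same as an arbitrary choice of its values [L (fdirac e)]. *)
Record finsupp := MkFinsupp
  { finsupp_val :> T -> R ; finsuppP : finsupp_val \in finsupp_pred }.

HB.instance Definition _ := [isSub for finsupp_val].
HB.instance Definition _ := [Choice of finsupp by <:].
HB.instance Definition _ := [SubChoice_isSubLmodule of finsupp by <:].

Lemma finsupp_finite (z : finsupp) : finite_set [set x | z x != 0].
Proof. by have := finsuppP z; rewrite inE. Qed.

Definition dirac_fun (e : T) : T -> R := fun x => (x == e)%:R.

Lemma dirac_finsupp e : dirac_fun e \in finsupp_pred.
Proof.
rewrite inE /=; apply: (@sub_finite_set _ _ [set e]); last exact: finite_set1.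
move=> x /=; have [->//|xe] := eqVneq x e.
by rewrite /dirac_fun (negPf xe) eqxx.
Qed.

Definition fdirac e : finsupp := MkFinsupp (dirac_finsupp e).

(** Linear forms below [possum] are those with all values [L (fdirac e)] between
    0 and 1. *)
Definition possum (z : finsupp) : R := \sum_(e \in [set: T]) Num.max 0 (z e).

Lemma possumE (s : {fset T}) (z : finsupp) :
  (forall x, z x != 0 -> x \in s) ->
  possum z = \sum_(e <- finmap.enum_fset s) Num.max 0 (z e).
Proof.
move=> zs; apply: fsbigTE => x xs; have [->|/zs] := eqVneq (z x) 0.
  by rewrite maxxx.
by rewrite (negPf xs).
Qed.

Definition fsupport (z : finsupp) : {fset T} := fset_set [set x | z x != 0].

Lemma in_fsupport z x : (x \in fsupport z) = (z x != 0).
Proof.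
rewrite in_fset_set; last exact: finsupp_finite.
by apply/idP/idP; rewrite inE.
Qed.

Lemma possum_sublinear : sublinear possum.
Proof.
split=> [x y|t x t0].
  pose s : {fset T} := finmap.fsetU (fsupport x) (fsupport y).
  have sx e : x e != 0 -> e \in s.
    by rewrite finmap.in_fsetU in_fsupport => ->.
  have sy e : y e != 0 -> e \in s.
    by rewrite finmap.in_fsetU !in_fsupport orbC => ->.
  rewrite (possumE sx) (possumE sy) (@possumE s (x + y)); last first.
    move=> e; rewrite -[(x + y) e]/(x e + y e) => xye.
    have [xe|/sx//] := eqVneq (x e) 0; apply: sy.
    by move: xye; rewrite xe add0r.
  have xyE e : (x + y) e = x e + y e by [].
  rewrite -big_split; apply: ler_sum => e _; rewrite xyE ge_max addr_ge0 ?le_max ?lexx//=.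
  by rewrite lerD// le_max lexx orbT.
have st e : (t *: x) e != 0 -> e \in fsupport x.
  rewrite in_fsupport; apply: contraNN => /eqP xe.
  by rewrite -[(t *: x) e]/(t * x e) xe mulr0.
rewrite (possumE st) (@possumE (fsupport x)); last by move=> e; rewrite in_fsupport.
rewrite mulr_sumr; apply: eq_bigr => e _.
by rewrite -[(t *: x) e]/(t * x e) maxr_pMr// mulr0.
Qed.

Lemma finsupp_decomp (z : finsupp) :
  z = \sum_(e <- finmap.enum_fset (fsupport z)) z e *: fdirac e.
Proof.
apply: val_inj; rewrite raddf_sum; apply/funext => x; rewrite fct_sumE.
rewrite (eq_bigr (fun e => z e * (x == e)%:R))//.
have [zx|zx] := boolP (x \in fsupport z).
  rewrite (bigD1_seq x) ?finmap.fset_uniq//= eqxx mulr1 big1 ?addr0// => e ex.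
  by rewrite eq_sym (negPf ex) mulr0.
rewrite big1_seq => [|e /= es].
  by apply/eqP; apply: contraNT zx; rewrite in_fsupport.
by have [xe|] := eqVneq x e; [move: zx; rewrite xe es|rewrite mulr0].
Qed.

End FiniteSupport.

Section Flow.
Context {R : realType} {T : choiceType}.

Lemma seq_min (s : seq T) (f : T -> R) : s != [::] ->
  exists2 x, x \in s & forall y, y \in s -> f x <= f y.
Proof.
elim: s => // a [|b s] IH _.
  by exists a; rewrite ?mem_head// => y; rewrite inE => /eqP ->.
have [//|x xs xmin] := IH.
have [ax|xa] := leP (f a) (f x).
  exists a; first exact: mem_head.
  by move=> y; rewrite inE => /predU1P[->//|/xmin]; exact: le_trans.
exists x; first by rewrite inE xs orbT.
by move=> y; rewrite inE => /predU1P[->|/xmin//]; exact: ltW.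
Qed.

Lemma count_lt (s : seq T) (P Q : pred T) x : subpred P Q ->
  x \in s -> Q x -> ~~ P x -> (count P s < count Q s)%N.
Proof.
move=> PQ + Qx Px; elim: s => // a s IH; rewrite inE => /predU1P[<-|xs] /=.
  by rewrite Qx (negPf Px) ltnS; exact: sub_count.
rewrite -addnS leq_add ?IH//.
by case: (boolP (P a)) => // /PQ ->.
Qed.

(** The coarea inequality: an isoperimetric inequality for sets extends to
    nonnegative functions, by peeling off the indicator of the support with the
    smallest nonzero value as coefficient. *)
Lemma coarea (s : seq T) (es : seq (T * T)) (d : R) :
  (forall F : pred T, (forall x, F x -> x \in s) ->
     d * \sum_(x <- s) (F x)%:R <= \sum_(e <- es) (F e.1 && ~~ F e.2)%:R) ->
  forall f : T -> R, (forall x, 0 <= f x) -> (forall x, f x != 0 -> x \in s) ->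
  d * \sum_(x <- s) f x <= \sum_(e <- es) Num.max 0 (f e.1 - f e.2).
Proof.
move=> iso f; have [n] := ubnP (size [seq x <- s | f x != 0]).
elim: n f => // n IH f; rewrite ltnS => sf f0 fs.
have [supp0|suppn0] := eqVneq [seq x <- s | f x != 0] [::].
  rewrite big1_seq ?mulr0; last first.
    move=> x /= xs; apply/eqP; apply/negPn/negP => fx.
    suff : x \in [seq x <- s | f x != 0] by rewrite supp0.
    by rewrite mem_filter fx.
  by rewrite sumr_ge0// => e _; rewrite le_max lexx.
have [m] := seq_min f suppn0; rewrite mem_filter => /andP[fm ms] minm.
have fm_min x : f x != 0 -> f m <= f x.
  by move=> fx; apply: minm; rewrite mem_filter fx fs.
pose g x := f x - f m * (f x != 0)%:R.
have g0 x : 0 <= g x.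
  rewrite /g; have [->|fx] := eqVneq (f x) 0; first by rewrite mulr0 subr0.
  by rewrite mulr1 subr_ge0; exact: fm_min.
have gf x : g x != 0 -> f x != 0.
  by apply: contraNN => /eqP fx; rewrite /g fx eqxx mulr0 subr0.
have fE x : f x = f m * (f x != 0)%:R + g x by rewrite /g addrC subrK.
have -> : \sum_(x <- s) f x =
    f m * \sum_(x <- s) (f x != 0)%:R + \sum_(x <- s) g x.
  by rewrite mulr_sumr -big_split/=; apply: eq_bigr => x _; exact: fE.
have -> : \sum_(e <- es) Num.max 0 (f e.1 - f e.2) =
    f m * \sum_(e <- es) ((f e.1 != 0) && ~~ (f e.2 != 0))%:R +
    \sum_(e <- es) Num.max 0 (g e.1 - g e.2).
  rewrite mulr_sumr -big_split/=; apply: eq_bigr => -[a b] _ /=.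
  have [a0|a0] := eqVneq (f a) 0; rewrite /= ?mulr0 ?add0r.
    have ga0 : g a = 0 by rewrite /g a0 eqxx mulr0 subr0.
    by rewrite a0 ga0 !sub0r !max_l// oppr_le0.
  have [b0|b0] := eqVneq (f b) 0; rewrite /= ?mulr0 ?add0r ?mulr1.
    have gb0 : g b = 0 by rewrite /g b0 eqxx mulr0 subr0.
    by rewrite b0 gb0 !subr0 !max_r// /g a0 mulr1 addrC subrK.
  congr Num.max; rewrite /g a0 b0 !mulr1 opprB addrA subrK//.
rewrite mulrDr lerD//.
  by rewrite mulrCA ler_wpM2l//; apply: iso => x; exact: fs.
apply: IH => //; last by move=> x /gf; exact: fs.
apply: leq_trans sf; rewrite !size_filter.
have gm : g m = 0 by rewrite /g fm mulr1 subrr.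
by apply: count_lt ms fm _; [move=> x /gf|rewrite /= gm eqxx].
Qed.

End Flow.

Section FlowTheorem.
Context {R : realType} {T : choiceType}.
Implicit Types (f : T -> R) (F : {fset T}).

Lemma sumr_card (K : choiceType) (s : {fset K}) (P : pred K) (H : {fset K}) :
  (forall x, (x \in H) = (x \in s) && P x) ->
  \sum_(x <- s) (P x)%:R = #|` H|%:R :> R.
Proof.
move=> HE; rewrite -natr_sum; congr _%:R.
have -> : (\sum_(x <- s) P x = count P s)%N.
  by elim: (enum_fset s) => [|a l IH]; rewrite ?big_nil ?big_cons//= IH.
rewrite -size_filter; apply/perm_size/uniq_perm; [exact/filter_uniq/fset_uniq|exact: fset_uniq|].
by move=> x; rewrite mem_filter HE andbC.
Qed.

(** The duality between edge expansion and flows. The set of pairs formed by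
    the gradient of a finitely supported nonnegative function and [d] times its
    total mass is a convex cone that lies, by the coarea inequality, below the
    sum of positive parts of the gradient; the Hahn-Banach theorem gives a
    linear form that represents the flow. *)
Lemma flow_exists (V : set T) (Ed : set (T * T)) (d : R) :
  (forall v, V v -> finite_set [set e | Ed e /\ (e.1 = v \/ e.2 = v)]) ->
  (forall F, {subset F <= V} ->
     d * #|` F|%:R <=
     #|` fset_set [set e | Ed e /\ (e.1 \in F /\ e.2 \notin F)] |%:R) ->
  exists c : T * T -> R, (forall e, 0 <= c e <= 1) /\
    forall f, (forall x, 0 <= f x) -> finite_set [set x | f x != 0] ->
      (forall x, f x != 0 -> V x) ->
      d * \sum_(x \in [set: T]) f x <= \sum_(e \in Ed) c e * (f e.1 - f e.2).
Proof.
move=> finE iso.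
pose adm f := [/\ forall x, 0 <= f x, finite_set [set x | f x != 0] &
  forall x, f x != 0 -> V x].
pose grad f e : R := if e \in Ed then f e.1 - f e.2 else 0.
pose star F := [set e | Ed e /\ (e.1 \in F \/ e.2 \in F)].
have fin_star F : {subset F <= V} -> finite_set (star F).
  move=> FV; apply: (@sub_finite_set _ _
      (\bigcup_(v in [set` F]) [set e | Ed e /\ (e.1 = v \/ e.2 = v)])).
    by move=> e [Ee [eF|eF]]; [exists e.1 => //=; split => //; left|
      exists e.2 => //=; split => //; right].
  by apply: bigcup_finite => // v /FV vV; apply: finE; rewrite -inE.
have supp_sub f F : (forall x, f x != 0 -> x \in F) ->
    forall e, grad f e != 0 -> star F e.
  move=> fF e; rewrite /grad; case: ifPn => [|_]; last by rewrite eqxx.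
  rewrite inE => Ee ne; split => //.
  have [f1|/fF] := eqVneq (f e.1) 0; last by left.
  have [f2|/fF] := eqVneq (f e.2) 0; last by right.
  by move: ne; rewrite f1 f2 subrr eqxx.
have adm_supp f : adm f -> exists F, {subset F <= V} /\ forall x, f x != 0 -> x \in F.
  move=> [f0 ff fV]; exists (fset_set [set x | f x != 0]).
  by split=> x; rewrite in_fset_set// inE => // /fV; rewrite inE.
have grad_fin f : adm f -> grad f \in finsupp_pred.
  move=> /adm_supp[F [FV fF]]; rewrite inE /=.
  apply: sub_finite_set (fin_star _ FV) => e; exact: supp_sub.
pose C := [set w : finsupp * R | exists f, [/\ adm f, w.1 = grad f :> (_ -> _) &
  w.2 = d * \sum_(x \in [set: T]) f x]].
have sumE f F : (forall x, f x != 0 -> x \in F) ->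
    \sum_(x \in [set: T]) f x = \sum_(x <- F) f x.
  move=> fF; apply: fsbigTE => x xF; apply/eqP; apply: contraNT xF; exact: fF.
have [|w1 w2|t w t0|w|L [sL Lp LC]] :=
  @hahn_banach_cone R (@finsupp R (T * T)%type) possum C possum_sublinear.
- exists (fun=> 0); split.
  + split => // [|x]; last by rewrite eqxx.
    by rewrite (_ : [set x | _] = set0)//; apply/seteqP; split => x //=; rewrite eqxx.
  + by apply/funext => e; rewrite /grad subrr if_same.
  + by rewrite fsbig1 ?mulr0.
- move=> [f [af fE fs]] [g [ag gE gs]]; exists (fun x => f x + g x).
  have [F [FV fF]] := adm_supp _ af; have [H [HV gH]] := adm_supp _ ag.
  have fgFH x : f x + g x != 0 -> x \in (F `|` H)%fset.
    rewrite in_fsetU; have [fx|/fF->//] := eqVneq (f x) 0.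
    by rewrite fx add0r => /gH ->; rewrite orbT.
  have FHV : {subset (F `|` H)%fset <= V}.
    by move=> x; rewrite in_fsetU => /orP[/FV|/HV].
  split.
  + split => [x||x /fgFH/FHV]; last by rewrite inE.
      by rewrite addr_ge0//; [case: af|case: ag].
    by apply: sub_finite_set (finite_fset (F `|` H)%fset) => x /fgFH.
  + apply/funext => e; rewrite -[LHS]/(w1.1 e + w2.1 e) fE gE /grad.
    by case: ifP => _; rewrite ?addr0//; ring.
  + rewrite /= fs gs -mulrDr (sumE _ _ fgFH) (@sumE f (F `|` H)%fset).
      rewrite (@sumE g (F `|` H)%fset) ?big_split// => x /gH.
      by rewrite in_fsetU => ->; rewrite orbT.
    by move=> x /fF; rewrite in_fsetU => ->.
- move=> [f [af fE fs]]; exists (fun x => t * f x).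
  have [F [FV fF]] := adm_supp _ af.
  have tfF x : t * f x != 0 -> x \in F.
    by rewrite mulf_eq0 negb_or => /andP[_ /fF].
  split.
  + split => [x||x /tfF/FV]; last by rewrite inE.
      by rewrite mulr_ge0 ?(ltW t0)//; case: af.
    by apply: sub_finite_set (finite_fset F) => x /tfF.
  + apply/funext => e; rewrite -[LHS]/(t * w.1 e) fE /grad.
    by case: ifP => _; rewrite ?mulr0// mulrBr.
  + by rewrite /= fs mulrCA (sumE _ _ tfF) (sumE _ _ fF) mulr_sumr.
- move=> [f [af fE ->]]; have [F [FV fF]] := adm_supp _ af.
  have finF := fin_star _ FV.
  rewrite (@possumE _ _ (fset_set (star F))); last first.
    by move=> e; rewrite fE in_fset_set// inE => /(supp_sub _ _ fF).
  rewrite (sumE _ _ fF).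
  have -> : \sum_(e <- fset_set (star F)) Num.max 0 (w.1 e) =
      \sum_(e <- fset_set (star F)) Num.max 0 (f e.1 - f e.2).
    rewrite big_seq [RHS]big_seq; apply: eq_bigr => e.
    by rewrite in_fset_set// inE fE /grad => -[Ee _]; rewrite mem_set.
  apply: coarea => //; last by case: af.
  move=> P PF.
  have [H HFP] : exists H : {fset T}, forall x, (x \in H) = (x \in F) && P x.
    by exists [fset x in F | P x]%fset => x; rewrite !inE.
  have HP x : (x \in H) = P x.
    by rewrite HFP; case: (boolP (P x)) => [/PF ->|]; rewrite ?andbF.
  have HV : {subset H <= V} by move=> x; rewrite HP => /PF/FV.
  have finH : finite_set [set e | Ed e /\ (e.1 \in H /\ e.2 \notin H)].
    by apply: sub_finite_set (fin_star _ HV) => e [Ee [eH _]]; split => //; left.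
  rewrite (@sumr_card _ _ _ H); last exact: HFP.
  rewrite (@sumr_card _ _ _ (fset_set [set e | Ed e /\ (e.1 \in H /\ e.2 \notin H)])).
    exact: iso.
  move=> e; rewrite !in_fset_set//; apply/idP/idP.
    move=> /set_mem[Ee []]; rewrite !HP => P1 P2; rewrite P1 P2 !andbT.
    by apply/mem_set; split => //; left; exact: PF.
  move=> /andP[/set_mem[Ee _] /andP[P1 P2]]; apply/mem_set.
  by split => //; rewrite !HP.
pose c e := L (fdirac e).
have L0 : L 0 = 0 by have := sL 1 0 0; rewrite scale1r addr0 mul1r; lra.
have Lsum (s : seq (T * T)) (a : T * T -> R) :
    L (\sum_(e <- s) a e *: fdirac e) = \sum_(e <- s) a e * c e.
  elim: s => [|e s IH]; first by rewrite !big_nil L0.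
  by rewrite !big_cons sL IH.
exists c; split => [e|f f0 ff fV].
  have LN : L (- fdirac e) = - c e.
    by have := sL (-1) (fdirac e) 0; rewrite L0 !addr0 scaleN1r mulN1r.
  have oneE (z : finsupp) : (forall x, x != e -> z x = 0) ->
      possum z = Num.max 0 (z e).
    move=> z0; rewrite (@possumE _ _ [fset e]%fset) ?big_seq_fset1// => x.
    by rewrite in_fset1; apply: contraNT => /z0 ->.
  have DE x : fdirac e x = (x == e)%:R by [].
  have NE x : (- fdirac e) x = - (x == e)%:R by [].
  apply/andP; split.
    rewrite -lerN2 -LN oppr0; apply: le_trans (Lp _) _.
    rewrite oneE => [|x xe]; rewrite NE ?eqxx ?(negPf xe) ?oppr0//.
  apply: le_trans (Lp _) _; rewrite oneE => [|x xe].
    by rewrite DE eqxx ge_max ler01 lexx.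
  by rewrite DE (negPf xe).
have af : adm f by split.
have [F [FV fF]] := adm_supp _ af.
pose z := MkFinsupp (grad_fin _ af).
have /= := LC (z, d * \sum_(x \in [set: T]) f x) _.
rewrite {2}(finsupp_decomp z) Lsum => /(_ _)/le_trans; apply.
  by exists f.
have zE e : z e = grad f e by [].
rewrite [leRHS]fsbig_mkcond.
rewrite [leRHS](@fsbigTE _ _ _ _ (fsupport z)); last first.
  move=> e; rewrite in_fsupport negbK zE /grad patchE => /eqP.
  by case: ifP => // _ ->; rewrite mulr0.
apply: ler_sum => e _; rewrite zE /grad patchE.
by case: ifP => _; rewrite ?mul0r// mulrC.
Qed.

End FlowTheorem.

(** * Displacing locally finite families *)

Section SparseFamilies.
Context {R : realType} {G : topologicalGroupType} {I : choiceType}.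
Implicit Types (J : set I) (g : I -> G) (c : I -> R) (X Q : set G).

(** A uniform form of local finiteness, which makes sums over the family both
    locally finite and bounded. *)
Definition sparse J g : Prop := forall Q, compact Q -> exists b : R,
  forall y (S : {fset I}), (forall i, i \in S -> J i /\ Q (g i * y^-1)%g) ->
    #|` S|%:R <= b.

Lemma sparse_finite J g Q y : sparse J g -> compact Q ->
  finite_set [set i | J i /\ Q (g i * y^-1)%g].
Proof.
move=> sp cQ; have [b Hb] := sp Q cQ; apply: contrapT.
move=> /(infinite_set_fset (Num.truncn b).+1)[S SJ bS].
have Sb := Hb y S (fun i iS => SJ i iS).
have : b < (Num.truncn b).+1%:R by exact: truncnS_gt.
by rewrite ltNge => /negP; apply; apply: le_trans Sb; rewrite ler_nat.
Qed.

Lemma rtranslate_mem X Q x y : rtranslate X x y -> X `<=` Q ->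
  setinv Q (x * y^-1)%g.
Proof.
by rewrite rtranslateE /setinv /= => Xyx XQ; rewrite invgM invgK; exact: XQ.
Qed.

Lemma sparse_locally_finite J g X Q : sparse J g -> compact Q -> X `<=` Q ->
  locally_finite J (fun i => rtranslate X (g i)).
Proof.
move=> sp cQ XQ P cP.
have cQP : compact (setmul (setinv Q) P).
  by apply: compact_setmul => //; exact: compact_setinv.
apply: sub_finite_set (sparse_finite 1%g sp cQP) => i /= [Ji [y [Xy Py]]].
split => //; exists (g i * y^-1)%g; first exact: (rtranslate_mem Xy XQ).
by exists y => //; rewrite mulgVK invg1 mulg1.
Qed.

Lemma sparse_bounded J g Q : sparse J g -> compact Q -> exists b : R,
  forall c X y, (forall i, 0 <= c i <= 1) -> X `<=` Q ->
    lfsum J c (fun i => rtranslate X (g i)) y <= b.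
Proof.
move=> sp cQ; have cQ' := compact_setinv cQ; have [b Hb] := sp _ cQ'.
exists b => c X y c01 XQ.
pose S := fset_set [set i | J i /\ setinv Q (g i * y^-1)%g].
have finS := sparse_finite y sp cQ'.
apply: (@le_trans _ _ #|` S|%:R); last first.
  by apply: (Hb y) => i; rewrite in_fset_set// inE.
rewrite /lfsum -(@fsbig_widen _ _ _ _ [set i | J i /\ setinv Q (g i * y^-1)%g]).
- rewrite fsbig_finite//= -sum1_size natr_sum; apply: ler_sum => i _.
  have /andP[c0 c1] := c01 i.
  by rewrite -[leRHS]mulr1 ler_pM// indicE lern1 leq_b1.
- by move=> i [].
- move=> i [Ji nQ] /=; rewrite indicE memNset ?mulr0// => Xi; apply: nQ.
  by split => //; exact: (rtranslate_mem Xi XQ).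
Qed.

Lemma fsum_restrict J (F : I -> R) (J' : set I) : finite_set J' ->
  (forall i, J i -> F i != 0 -> J' i) ->
  \sum_(i \in J) F i = \sum_(i <- fset_set (J `&` J')) F i.
Proof.
move=> fJ' FJ.
have finJ : finite_set (J `&` J') by apply: sub_finite_set fJ' => i [].
rewrite -fsbig_finite//; apply/esym/fsbig_widen; first by move=> i [].
by move=> i [Ji nJ]; apply: contrapT => /eqP Fi; apply: nJ; split => //; exact: FJ.
Qed.

Lemma fsumrB J (F F' : I -> R) (J' : set I) : finite_set J' ->
  (forall i, J i -> F i != 0 -> J' i) -> (forall i, J i -> F' i != 0 -> J' i) ->
  \sum_(i \in J) (F i - F' i) = \sum_(i \in J) F i - \sum_(i \in J) F' i.
Proof.
move=> fJ' FJ F'J; rewrite (fsum_restrict fJ' FJ) (fsum_restrict fJ' F'J).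
rewrite (@fsum_restrict _ _ J') ?sumrB// => i Ji.
have [Fi|/(FJ _ Ji)//] := eqVneq (F i) 0.
by rewrite Fi sub0r oppr_eq0 => /(F'J _ Ji).
Qed.

Lemma ler_fsum J (F F' : I -> R) (J' : set I) : finite_set J' ->
  (forall i, J i -> F i != 0 -> J' i) -> (forall i, J i -> F' i != 0 -> J' i) ->
  (forall i, J i -> F i <= F' i) ->
  \sum_(i \in J) F i <= \sum_(i \in J) F' i.
Proof.
move=> fJ' FJ F'J FF'; rewrite (fsum_restrict fJ' FJ) (fsum_restrict fJ' F'J).
rewrite big_seq [leRHS]big_seq; apply: ler_sum => i.
rewrite in_fset_set; last by apply: sub_finite_set fJ' => j [].
by rewrite inE => -[/FF'].
Qed.

End SparseFamilies.

Lemma ratio_trans (R : realFieldType) (n c d x y z : R) :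
  0 < n -> 0 < c -> 0 < d -> n * x <= d * y -> c * y <= n * z -> c * x <= d * z.
Proof.
move=> n0 c0 d0 xy yz; rewrite -(ler_pM2l n0).
have := ler_wpM2l (ltW c0) xy; have := ler_wpM2l (ltW d0) yz.
lra.
Qed.

Section Wobbling.
Context {R : realType} {G : topologicalGroupType} {I : choiceType}.
Variable h : {measure set (borel G) -> \bar R}.
Implicit Types (J : set I) (g : I -> G) (c : I -> R) (X Q C D N W : set G).
Hypothesis hG : hausdorff_space G.
Hypothesis lcG : locally_compact [set: G].
Hypothesis haarh : left_haar h.
Hypothesis uh : unimodular h.
Local Notation vol := (vol h).
Local Notation translates X g := (fun i => rtranslate X (g i)).

Lemma compact_thicken C (U : set G) (e : R) : compact C -> open U ->
  C `<=` U -> 0 < e -> exists D N, [/\ compact D, open_nbhs (1%g : G) N,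
    forall x a b d, C x -> N a -> N b -> N d -> D (x * (a * b * d))%g,
    D `<=` U & vol D < vol C + e].
Proof.
move=> cC oU CU e0; have fC := compact_finmeas hG haarh cC.
have [P [oP CP fP PC]] := outer_regular haarh fC e0.
have [|K [cK K1 CK]] := @compact_sub_setmul _ lcG C (P `&` U) cC (openI oP oU).
  by move=> x Cx; split; [exact: CP|exact: CU].
have [N N1 NK] := nbhs1_mul3 K1.
have cD : compact (setmul C K) by exact: compact_setmul.
exists (setmul C K), N; split => //.
- move=> x a b d Cx Na Nb Nd; exists x => //; exists (a * b * d)%g => //.
  exact: NK.
- by move=> x /CK[].
- apply: le_lt_trans PC; apply: le_vol => //; last by move=> x /CK[].
  exact: (compact_borel_set hG haarh cD).
Qed.

Lemma rtranslate_loc_measurable X x : open X -> loc_measurable h (rtranslate X x).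
Proof.
move=> oX F mF _; apply: measurableI => //.
by apply: open_borel_set; exact: open_rtranslate.
Qed.

Lemma slice_rtranslate D V a y :
  slice D (rtranslate V a) y = D `&` ltranslate (y * a^-1)%g (setinv V).
Proof.
apply/seteqP; split => x [Dx]; rewrite rtranslateE ltranslateE /setinv /= => Vx.
  by split => //=; rewrite !invgM !invgK mulgA.
by split => //; move: Vx; rewrite /= !invgM !invgK mulgA.
Qed.

(** Both means are compared with that of the sum of the translates [V (a i)] of
    a very small set. Its convolution with the uniform density on [C] is at most
    [vol (setinv V) / vol C] times the sum over the family [a]. Its convolution
    with the uniform density on [D w] is at least [vol (setinv V) / vol D] times
    the part of the sum over the family [b] in which the displacement is close
    to [w], and finitely many [w] suffice as [W] is compact. When [D] is close to
    [C] in volume, this says that the mean cannot detect the displacements. *)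
Lemma mean_displaced_le (mu : Linfty h -> R) J c (a b : I -> G) C D N W :
  TLIM h mu -> (forall i, 0 <= c i <= 1) ->
  @sparse R _ _ J a -> @sparse R _ _ J b -> compact W ->
  (forall i, J i -> W (b i * (a i)^-1)%g) ->
  compact C -> 0 < vol C -> compact D -> open_nbhs (1%g : G) N ->
  C `<=` D ->
  (forall x u v w, C x -> N u -> N v -> N w -> D (x * (u * v * w))%g) ->
  vol C * mean_fun mu (lfsum J c (translates (setmul C N) b)) <=
  vol D * mean_fun mu (lfsum J c (translates (setmul C N) a)).
Proof.
move=> tmu c01 spa spb cW Wab cC C0 cD [oN N1] CD CND.
have mmu : means h mu by case: tmu.
have c0 i : 0 <= c i by have /andP[] := c01 i.
pose X := setmul C N.
have oX : open X by exact: open_setmul.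
have XD : X `<=` D.
  move=> _ [x Cx [n Nn <-]].
  by have := CND _ _ _ _ Cx Nn N1 N1; rewrite !mulg1.
have D0 : 0 < vol D.
  apply: lt_le_trans C0 _; apply: le_vol => //.
    exact: (compact_borel_set hG haarh cC).
  exact: (compact_finmeas hG haarh cD).
have [ws Wws] : exists ws : {fset G},
    forall w, W w -> exists2 u, u \in ws & rtranslate N u w.
  move: cW; rewrite compact_cover => /(_ G W (fun u => rtranslate N u)).
  case=> [u _|w Ww|ws _ Wws]; first exact: open_rtranslate.
    by exists w => //; exists 1%g => //; rewrite mul1g.
  by exists ws => w /Wws[u]; exists u.
have [wt Hwt] : exists wt : I -> G, forall i, J i ->
    wt i \in ws /\ rtranslate N (wt i) (b i * (a i)^-1)%g.
  suff : forall i, exists u, J i -> u \in ws /\ rtranslate N u (b i * (a i)^-1)%g.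
    by move=> /choice[wt Hwt]; exists wt.
  move=> i; have [Ji|nJi] := pselect (J i); last by exists 1%g.
  by have [u] := Wws _ (Wab _ Ji); exists u.
(* so small that x n w v^-1 stays in D w, for x in X, n in N and v in V0 *)
pose V0 := [set v : G | N v /\ forall u, u \in ws -> N (u * v^-1 * u^-1)%g].
have V01 : nbhs (1%g : G) V0.
  apply: filterI; first exact: open_nbhs_nbhs.
  have near_u u : \forall v \near (1%g : G), N (u * v^-1 * u^-1)%g.
    have : (fun v : G => u * v^-1 * u^-1)%g @ (1%g : G) --> (1%g : G).
      rewrite -[X in _ --> X](_ : u * (1%g : G)^-1 * u^-1 = _)%g; last first.
        by rewrite invg1 mulg1 mulgV.
      apply: (@continuous_comp _ _ _ (fun v => u * v^-1)%g (fun v => v * u^-1)%g).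
        apply: (@continuous_comp _ _ _ (fun v => v^-1)%g (fun v => u * v)%g).
          exact: invg_continuous.
        exact: lmul_continuous.
      exact: rmul_continuous.
    by apply; exact: open_nbhs_nbhs.
  have : nbhs (1%g : G) (\bigcap_(u in [set` ws]) [set v | N (u * v^-1 * u^-1)%g]).
    by apply: filter_bigI => u _; exact: near_u.
  by apply: filterS => v Hv u us; exact: Hv.
have [K [cK K1 KV]] := compact_nbhs1 lcG V01.
pose V := K°.
have oV : open V by exact: open_interior.
have V1 : V 1%g by [].
have VK : V `<=` K by exact: interior_subset.
have oV' : open (setinv V) by exact: open_setinv.
have fV' : finmeas h (setinv V).
  apply: (sub_compact_finmeas hG haarh (open_borel_set oV') _ (compact_setinv cK)).
  by move=> v /VK.
pose nu := vol (setinv V).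
have nu0 : 0 < nu.
  by apply: open_vol_gt0 => //; exists 1%g; rewrite /setinv /= invg1.
have mV i : loc_measurable h (rtranslate V (a i)) by exact: rtranslate_loc_measurable.
have lfV : locally_finite J (translates V a) by exact: (sparse_locally_finite spa cK).
have lfXa : locally_finite J (translates X a) by exact: (sparse_locally_finite spa cD).
have lfXb : locally_finite J (translates X b) by exact: (sparse_locally_finite spb cD).
have sumP (e : I -> R) g (Y Q : set G) : (forall i, 0 <= e i <= 1) ->
    @sparse R _ _ J g -> open Y -> compact Q -> Y `<=` Q ->
    lfsum J e (translates Y g) \in Linfty_pred h.
  move=> e01 sp oY cQ YQ; have [B HB] := sparse_bounded sp cQ.
  apply: (@lfsum_open_Linfty _ _ _ lcG _ _ _ _ B).
  - by move=> i; have /andP[] := e01 i.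
  - by move=> i; exact: open_rtranslate.
  - exact: (sparse_locally_finite sp cQ).
  - by move=> y; exact: HB.
pose part w i := c i * (wt i == w)%:R.
have part01 w i : 0 <= part w i <= 1.
  have /andP[ci0 ci1] := c01 i.
  by rewrite /part; case: eqP => _; rewrite ?mulr1 ?mulr0 ?lexx ?ler01 ?ci0.
have part0 w i : 0 <= part w i by have /andP[] := part01 w i.
have hit y g (Y : set G) : locally_finite J (translates Y g) ->
    finite_set [set i | J i /\ rtranslate Y (g i) y].
  have cy : compact [set y] by exact: compact_set1.
  move=> /(_ _ cy); apply: sub_finite_set => i /= [Ji Yy].
  by split => //; exists y.
have lower w : w \in ws -> nu * mean_fun mu (lfsum J (part w) (translates X b)) <=
    vol D * mean_fun mu (lfsum J (part w) (translates V a)).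
  move=> wws; have cDw : compact (rtranslate D w) by exact: compact_rtranslate.
  have vDw : vol (rtranslate D w) = vol D.
    by apply: vol_rtranslate => //; exact: (compact_borel_set hG haarh cD).
  have VP := sumP _ _ _ _ (part01 w) spa oV cK VK.
  have XP := sumP _ _ _ _ (part01 w) spb oX cD XD.
  have [B HB] := sparse_bounded spa cK.
  have convP : conv_lfsum h (rtranslate D w) J (part w) (translates V a)
      \in Linfty_pred h.
    apply: (@conv_lfsum_Linfty _ _ _ hG lcG haarh _ _ _ _ _ B) => //.
      by rewrite vDw.
    by move=> y; exact: HB.
  rewrite (TLIM_lfsum hG haarh tmu cDw _ (part0 w) mV lfV VP) ?vDw//.
  rewrite -!(mean_funZ mmu)//; apply: (le_mean_fun mmu) => [||y].
  - exact: LinftyZ.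
  - exact: LinftyZ.
  - rewrite /conv_lfsum vDw mulrA mulfV ?gt_eqF// mul1r /lfsum mulr_fsumr.
    pose Q := setmul (setinv (rtranslate D w)) [set y].
    have cQ : compact Q.
      by apply: compact_setmul; [exact: compact_setinv|exact: compact_set1].
    apply: (@ler_fsum _ _ _ _ _
        ([set i | J i /\ rtranslate X (b i) y] `|`
         [set i | J i /\ rtranslate V (a i) `&` Q !=set0])).
    + by rewrite finite_setU; split; [exact: hit|exact: lfV].
    + move=> i Ji; rewrite indicE => ne; left; split => //.
      by apply: contrapT => nX; move: ne; rewrite memNset ?mulr0 ?eqxx.
    + move=> i Ji ne; right; split => //; apply: (@slice_support _ _ h).
      by apply: contraNN ne => /eqP ->; rewrite mulr0.
    + move=> i Ji; rewrite mulrCA.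
      have [iw|iw] := eqVneq (wt i) w; last first.
        by rewrite /part (negPf iw) mulr0 !mul0r.
      rewrite ler_wpM2l// indicE.
      have [Xy|nXy] := pselect (rtranslate X (b i) y); last first.
        by rewrite memNset ?mulr0 ?vol_ge0.
      rewrite mem_set// mulr1 slice_rtranslate setIidr.
        by rewrite vol_ltranslate//; case: fV'.
      move: (Hwt _ Ji) => [_]; rewrite iw => -[n Nn nw].
      move: Xy => [_ [x Cx [m Nm <-]] <-] _ [v Vv <-].
      have [_ /(_ w wws) Nwv] := KV _ (VK _ Vv).
      rewrite invgK in Nwv.
      rewrite rtranslateE /=.
      have bE : b i = (n * w * a i)%g by rewrite nw mulgVK.
      rewrite (_ : _ / w = x * (m * n * (w * v * w^-1)))%g; first exact: CND.
      by rewrite bE !mulgA mulgK.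
have upper : vol C * mean_fun mu (lfsum J c (translates V a)) <=
    nu * mean_fun mu (lfsum J c (translates X a)).
  have VP := sumP _ _ _ _ c01 spa oV cK VK.
  have XP := sumP _ _ _ _ c01 spa oX cD XD.
  have [B HB] := sparse_bounded spa cK.
  have convP : conv_lfsum h C J c (translates V a) \in Linfty_pred h.
    apply: (@conv_lfsum_Linfty _ _ _ hG lcG haarh _ _ _ _ _ B) => //.
    by move=> y; exact: HB.
  rewrite (TLIM_lfsum hG haarh tmu cC _ c0 mV lfV VP)//.
  rewrite -!(mean_funZ mmu)//; apply: (le_mean_fun mmu) => [||y].
  - exact: LinftyZ.
  - exact: LinftyZ.
  - rewrite /conv_lfsum mulrA mulfV ?gt_eqF// mul1r /lfsum mulr_fsumr.
    pose Q := setmul (setinv C) [set y].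
    have cQ : compact Q.
      by apply: compact_setmul; [exact: compact_setinv|exact: compact_set1].
    apply: (@ler_fsum _ _ _ _ _
        ([set i | J i /\ rtranslate X (a i) y] `|`
         [set i | J i /\ rtranslate V (a i) `&` Q !=set0])).
    + by rewrite finite_setU; split; [exact: hit|exact: lfV].
    + move=> i Ji ne; right; split => //; apply: (@slice_support _ _ h).
      by apply: contraNN ne => /eqP ->; rewrite mulr0.
    + move=> i Ji; rewrite indicE => ne; left; split => //.
      by apply: contrapT => nX; move: ne; rewrite memNset ?mulr0 ?eqxx.
    + move=> i Ji; rewrite [leRHS]mulrCA ler_wpM2l// indicE.
      have [Xy|nXy] := pselect (rtranslate X (a i) y).
        rewrite mem_set// mulr1 slice_rtranslate.
        apply: (@le_trans _ _ (vol (ltranslate (y * (a i)^-1)%g (setinv V)))).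
          apply: le_vol; [|exact: subIsetr|exact: finmeas_ltranslate].
          apply: measurableI; first exact: (compact_borel_set hG haarh cC).
          by apply: borel_set_ltranslate; case: fV'.
        by rewrite vol_ltranslate//; case: fV'.
      rewrite memNset// mulr0 (_ : slice _ _ _ = set0) ?/vol ?measure0//.
      apply/seteqP; split => // x [Cx [v Vv vy]]; apply: nXy.
      exists (x * v)%g.
        by exists x => //; exists v => //; have [] := KV _ (VK _ Vv).
      by rewrite -mulgA vy mulVKg.
have split_part (g : I -> G) (Y : set G) : locally_finite J (translates Y g) ->
    lfsum J c (translates Y g) =
    (fun y => \sum_(w <- ws) lfsum J (part w) (translates Y g) y).
  move=> lf; apply/funext => y.
  have cy : compact [set y] by exact: compact_set1.
  rewrite (lfsum_seq c lf cy)//.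
  under [RHS]eq_bigr do rewrite (lfsum_seq _ lf cy)//.
  rewrite exchange_big/= big_seq [RHS]big_seq; apply: eq_bigr => i.
  rewrite in_fset_set; last exact: lf.
  rewrite inE => -[/Hwt[wiw _] _].
  rewrite (bigD1_seq (wt i)) ?fset_uniq//= /part eqxx mulr1 big1 ?addr0// => w.
  by rewrite eq_sym => /negPf ->; rewrite mulr0 mul0r.
have lower_sum : nu * mean_fun mu (lfsum J c (translates X b)) <=
    vol D * mean_fun mu (lfsum J c (translates V a)).
  rewrite (split_part b X)// (split_part a V)//.
  rewrite !(mean_fun_sum mmu); last 2 first.
  - by move=> w; exact: (sumP _ _ _ _ (part01 w) spa oV cK VK).
  - by move=> w; exact: (sumP _ _ _ _ (part01 w) spb oX cD XD).
  rewrite !mulr_sumr big_seq [leRHS]big_seq; apply: ler_sum => w; exact: lower.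
exact: (ratio_trans nu0 C0 D0 lower_sum upper).
Qed.
End Wobbling.

(** * Folner sets from a maximal separated set *)

Section Nets.
Context {R : realType} {G : topologicalGroupType}.
Variable h : {measure set (borel G) -> \bar R}.
Implicit Types (A C D K N Q T V W X Gam : set G).
Hypothesis hG : hausdorff_space G.
Hypothesis lcG : locally_compact [set: G].
Hypothesis haarh : left_haar h.
Hypothesis uh : unimodular h.
Local Notation vol := (vol h).

Definition separated V Gam : Prop := forall a b, Gam a -> Gam b ->
  rtranslate V a `&` rtranslate V b !=set0 -> a = b.

(** By maximality [V p] meets [V g] for some [g] in the set, which places [p] in
    [V^-1 V g]. *)
Lemma maximal_separated V : V 1%g -> exists Gam, separated V Gam /\
  forall p, exists2 g, Gam g & setmul (setinv V) V (p * g^-1)%g.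
Proof.
move=> V1; have [|Gam [sG maxG]] := @Zorn_bigcup _ (separated V).
  move=> F Fsep tF a b [X FX Xa] [Y FY Yb].
  by have [XY|YX] := tF _ _ FX FY;
    [apply: (Fsep Y) => //; exact: XY|apply: (Fsep X) => //; exact: YX].
exists Gam; split => // p; have [Gp|Gp] := pselect (Gam p).
  by exists p => //; rewrite mulgV; exists 1%g; [rewrite /setinv /= invg1|exists 1%g; rewrite ?mulg1].
apply: contrapT => np; apply: (maxG (p |` Gam)).
  by split; [exact: subsetUr|move=> sub; apply: Gp; apply: sub; left].
have key b : Gam b -> rtranslate V p `&` rtranslate V b !=set0 -> False.
  move=> Gb [z [[v Vv vz] [w Vw wz]]]; apply: np; exists b => //.
  exists v^-1%g; first by rewrite /setinv /= invgK.
  exists w => //; apply: (@mulIg _ b); rewrite mulgVK -mulgA wz -vz.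
  by rewrite mulKg.
move=> a b [->|Ga] [->|Gb] // ne; first by case: (key b Gb ne).
  by case: (key a Ga); rewrite setIC.
exact: sG.
Qed.

(** Disjoint right translates of [V], all of the same volume by unimodularity,
    fit into [K Q y], whose volume does not depend on [y]. *)
Lemma separated_sparse V K Gam : open V -> V 1%g -> V `<=` K -> compact K ->
  separated V Gam -> sparse Gam (id : G -> G) (R := R).
Proof.
move=> oV V1 VK cK sG Q cQ.
have cKQ : compact (setmul K Q) by exact: compact_setmul.
have mV := open_borel_set oV.
have fV := sub_compact_finmeas hG haarh mV VK cK.
have V0 : 0 < vol V by apply: open_vol_gt0 => //; exists 1%g.
exists (vol (setmul K Q) / vol V) => y S SG; rewrite ler_pdivlMr//.
have -> : #|` S|%:R * vol V = \sum_(g \in [set` S]) vol (rtranslate V g).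
  rewrite fsbig_finite//= set_fsetK.
  rewrite (eq_bigr (fun=> vol V)); last by move=> g _; exact: vol_rtranslate.
  by rewrite big_const_seq iter_addr_0 count_predT mulr_natl.
rewrite -vol_fbigcup; last 3 first.
- exact: finite_fset.
- by move=> a b /SG[Ga _] /SG[Gb _]; exact: sG.
- by move=> g _; exact: finmeas_rtranslate.
rewrite -(vol_rtranslate uh y (compact_borel_set hG haarh cKQ)).
apply: le_vol.
- by apply: fin_bigcup_measurable; [exact: finite_fset|move=> g _; exact: borel_set_rtranslate].
- move=> _ [g /SG[_ Qg] [v Vv <-]]; exists (v * (g * y^-1))%g.
    by exists v; [exact: VK|exists (g * y^-1)%g].
  by rewrite -mulgA mulgVK.
- exact/(compact_finmeas hG haarh)/compact_rtranslate.
Qed.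

Definition net_edges Gam W : set (G * G) :=
  [set e | [/\ Gam e.1, Gam e.2 & W (e.2 * (e.1)^-1)%g]].

(** An endpoint of an edge confines the other one to a translate of a fixed
    compact set, so that bounds for the vertices give bounds for the edges. *)
Lemma sparse_edges Gam W :
  sparse Gam (id : G -> G) (R := R) -> compact W ->
  sparse (net_edges Gam W) fst (R := R) /\ sparse (net_edges Gam W) snd (R := R).
Proof.
move=> sG cW.
have prod Q1 Q2 : compact Q1 -> compact Q2 -> exists b : R, forall y (S : {fset G * G}),
    (forall e, e \in S -> net_edges Gam W e /\
      Q1 (e.1 * y^-1)%g /\ Q2 (e.2 * y^-1)%g) -> #|` S|%:R <= b.
  move=> /sG[b1 Hb1] /sG[b2 Hb2]; exists (b1 * b2) => y S SE.
  pose S1 := [fset e.1 | e in S]%fset; pose S2 := [fset e.2 | e in S]%fset.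
  apply: (@le_trans _ _ (#|` S1|%:R * #|` S2|%:R)); last first.
    apply: ler_pM => //.
      by apply: (Hb1 y) => _ /imfsetP[e /SE[[? _ _] [? _]] ->].
    by apply: (Hb2 y) => _ /imfsetP[e /SE[[_ ? _] [_ ?]] ->].
  rewrite -natrM ler_nat -(size_allpairs pair); apply: uniq_leq_size => //.
  move=> e eS; apply/allpairsP; exists e; split; last by case: e eS.
    by apply/imfsetP; exists e.
  by apply/imfsetP; exists e.
split=> Q cQ.
  have [|b Hb] := prod Q (setmul W Q) cQ; first exact: compact_setmul.
  exists b => y S SE; apply: (Hb y) => e /SE[[G1 G2 We] Qe]; split => //; split => //.
  exists (e.2 * (e.1)^-1)%g => //; exists (e.1 * y^-1)%g => //.
  by rewrite mulgA mulgVK.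
have [|b Hb] := prod (setmul (setinv W) Q) Q _ cQ.
  by apply: compact_setmul => //; exact: compact_setinv.
exists b => y S SE; apply: (Hb y) => e /SE[[G1 G2 We] Qe]; split => //; split => //.
exists (e.1 * (e.2)^-1)%g; first by rewrite /setinv /= invgF.
by exists (e.2 * y^-1)%g => //; rewrite mulgA mulgVK.
Qed.

End Nets.

Section Folner.
Context {R : realType} {G : topologicalGroupType}.
Variable h : {measure set (borel G) -> \bar R}.
Implicit Types (A C D K N Q T V W X Gam : set G).
Hypothesis hG : hausdorff_space G.
Hypothesis lcG : locally_compact [set: G].
Hypothesis haarh : left_haar h.
Hypothesis uh : unimodular h.
Local Notation vol := (vol h).

Lemma vol_symdiff_ltranslate x T : compact T ->
  vol (ltranslate x T `+` T) = 2 * vol (ltranslate x T `\` T).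
Proof.
move=> cT; have cxT := compact_ltranslate (x := x) cT.
have fT := compact_finmeas hG haarh cT; have fxT := compact_finmeas hG haarh cxT.
have [mT _] := fT; have [mxT _] := fxT.
have vD A B : finmeas h A -> finmeas h B -> finmeas h (A `\` B).
  move=> fA [mB _]; apply: (finmeas_sub _ (@subDsetl _ _ _) fA).
  by apply: measurableD => //; case: fA.
rewrite /setY vol_setU; [|exact: vD|exact: vD|]; last first.
  by apply/seteqP; split => // z [[? ?] [? ?]].
have := vol_setUI fxT mT; have := vol_setUI fT mxT.
rewrite (vol_ltranslate haarh)// setIC => e1 e2.
by rewrite mulrDl mul1r; congr (_ + _); apply: (addrI (vol (ltranslate x T `&` T))); rewrite -e1 -e2.
Qed.

Lemma sparse_fiber (I : choiceType) (J : set I) (g : I -> G) v :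
  sparse J g (R := R) -> finite_set [set i | J i /\ g i = v].
Proof.
move=> sp; apply: sub_finite_set (sparse_finite v sp (@compact_set1 _ 1%g)).
by move=> i [Ji <-]; split => //=; rewrite mulgV.
Qed.

(** If [x] moves a point of [U g] out of [T], the new point lies in some [U g']
    for which [(g, g')] is an edge that leaves [F], since [W] contains all such
    displacements. The bound does not depend on [x], so that a small edge
    boundary makes [T] almost invariant under all of [K] at once. *)
Lemma net_folner V K0 K Gam :
  V `<=` K0 -> open V -> V 1%g -> compact K0 -> compact K -> separated V Gam ->
  (forall p, exists2 g, Gam g & setmul (setinv V) V (p * g^-1)%g) ->
  let U := setmul (setinv K0) K0 in
  let W := setmul (setmul (setinv U) K) U in
  forall F : {fset G}, {subset F <= Gam} ->
  let T := \bigcup_(g in [set` F]) rtranslate U g in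
  [/\ compact T, #|` F|%:R * vol V <= vol T & forall x, K x ->
    vol (ltranslate x T `\` T) <=
    #|` fset_set [set e | net_edges Gam W e /\ (e.1 \in F /\ e.2 \notin F)]|%:R
      * vol U].
Proof.
move=> VK0 oV V1 cK0 cK sG cov U W F FG T.
have cU : compact U by apply: compact_setmul => //; exact: compact_setinv.
have cW : compact W.
  by apply: compact_setmul => //; apply: compact_setmul => //; exact: compact_setinv.
have fU := compact_finmeas hG haarh cU; have [mU _] := fU.
have fV := sub_compact_finmeas hG haarh (open_borel_set oV) VK0 cK0.
have [mV _] := fV.
have VU : V `<=` U.
  move=> v /VK0 Kv; exists 1%g; first by rewrite /setinv /= invg1; exact: VK0.
  by exists v => //; rewrite mul1g.
have cT : compact T.
  rewrite /T bigcup_fset; apply: bigsetU_compact => g _.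
  exact: compact_rtranslate.
have fT := compact_finmeas hG haarh cT; have [mT _] := fT.
split => // [|x Kx].
  have fVg (g : G) : [set` F] g -> finmeas h (rtranslate V g).
    by move=> _; exact: finmeas_rtranslate.
  have -> : #|` F|%:R * vol V = vol (\bigcup_(g in [set` F]) rtranslate V g).
    rewrite (vol_fbigcup (finite_fset F))//; last first.
      by move=> a b /FG/set_mem Ga /FG/set_mem Gb; exact: sG.
    rewrite fsbig_finite//= set_fsetK.
    rewrite (eq_bigr (fun=> vol V)); last by move=> g _; exact: vol_rtranslate.
    by rewrite big_const_seq iter_addr_0 count_predT mulr_natl.
  apply: le_vol => //.
    by apply: fin_bigcup_measurable => // g _; exact: borel_set_rtranslate.
  move=> z [g Fg [v Vv <-]]; exists g => //; exists v => //; exact: VU.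
set cut := [set e | _].
have fcut : finite_set cut.
  have sp := separated_sparse hG haarh uh oV V1 VK0 cK0 sG.
  have [sp1 _] := sparse_edges sp cW.
  apply: (@sub_finite_set _ _
      (\bigcup_(g in [set` F]) [set e | net_edges Gam W e /\ e.1 = g])).
    by move=> e [Ee [eF _]]; exists e.1.
  by apply: bigcup_finite => // g _; exact: sparse_fiber.
apply: (@le_trans _ _ (\sum_(e \in cut) vol (rtranslate U e.2))).
  apply: vol_fbigcup_le => //.
  - by move=> e _; exact: finmeas_rtranslate.
  - by apply: measurableD => //; exact: borel_set_ltranslate.
  - move=> _ [[t [g Fg [u Uu <-]] <-] nT].
    have [g' Gg' [w Ww [v Vv wv]]] := cov (x * (u * g))%g.
    have Ug' : U (x * (u * g) * g'^-1)%g.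
      rewrite -wv; exists w; first exact: VK0.
      by exists v => //; exact: VK0.
    have zg' : rtranslate U g' (x * (u * g))%g by rewrite rtranslateE.
    exists (g, g') => //; split; last first.
      by split => //=; apply/negP => Fg'; apply: nT; exists g'.
    split => //=; first exact/set_mem/FG.
    exists ((x * (u * g) * g'^-1)^-1 * x)%g.
      by exists (x * (u * g) * g'^-1)^-1%g; [rewrite /setinv /= invgK|exists x].
    exists u => //; by rewrite invgF !invgM !mulgA !mulgVK.
rewrite fsbig_finite//= (eq_bigr (fun=> vol U)); last first.
  by move=> e _; exact: vol_rtranslate.
by rewrite big_const_seq iter_addr_0 count_predT mulr_natl.
Qed.

(** If no finite subset of the net had a small edge boundary, a bounded flow on
    the edges would have a definite surplus at each point of the net. Spreading
    it out over translates of [U] bounds the difference of two functions from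
    below by a constant, although the mean does not distinguish the two
    functions, as one arises from the other by bounded displacements. *)
Lemma folner_exists (mu : Linfty h -> R) K (eps : R) : TLIM h mu ->
  compact K -> 0 < eps -> exists T, [/\ compact T, 0 < vol T &
    forall x, K x -> vol (ltranslate x T `+` T) < eps * vol T].
Proof.
move=> tmu cK e0; have mmu : means h mu by case: tmu.
apply: contrapT => noF.
have [K0 [cK0 K01 _]] := compact_nbhs1 lcG (@filterT _ (nbhs (1%g : G)) _).
pose V := K0°.
have oV : open V by exact: open_interior.
have V1 : V 1%g by [].
have VK0 : V `<=` K0 by exact: interior_subset.
have mV := open_borel_set oV.
have fV := sub_compact_finmeas hG haarh mV VK0 cK0.
have vV : 0 < vol V by apply: open_vol_gt0 => //; exists 1%g.
have [Gam [sG cov]] := maximal_separated V1.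
have sparseG := separated_sparse hG haarh uh oV V1 VK0 cK0 sG.
pose U := setmul (setinv K0) K0.
have cU : compact U by apply: compact_setmul => //; exact: compact_setinv.
have VU : V `<=` U.
  move=> v /VK0 Kv; exists 1%g; first by rewrite /setinv /= invg1; exact: VK0.
  by exists v => //; rewrite mul1g.
have vU : 0 < vol U.
  apply: lt_le_trans vV _; apply: le_vol => //; exact: (compact_finmeas hG haarh cU).
pose W := setmul (setmul (setinv U) K) U.
have cW : compact W.
  by apply: compact_setmul => //; apply: compact_setmul => //; exact: compact_setinv.
pose Ed := net_edges Gam W.
have [sp1 sp2] := sparse_edges sparseG cW.
(* the factor 2 is that of vol_symdiff_ltranslate *)
pose d := eps * vol V / (2 * vol U).
have d0 : 0 < d by rewrite divr_gt0// ?mulr_gt0.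
have finE v : Gam v -> finite_set [set e | Ed e /\ (e.1 = v \/ e.2 = v)].
  move=> _; have : finite_set ([set e | Ed e /\ e.1 = v] `|` [set e | Ed e /\ e.2 = v]).
    by rewrite finite_setU; split; exact: sparse_fiber.
  by apply: sub_finite_set => e [Ee [ev|ev]]; [left|right].
have iso (F : {fset G}) : {subset F <= Gam} -> d * #|` F|%:R <=
    #|` fset_set [set e | Ed e /\ (e.1 \in F /\ e.2 \notin F)] |%:R.
  move=> FG; have [->|/fset0Pn[g gF]] := eqVneq F fset0.
    by rewrite cardfs0 mulr0.
  have [cT FT TF] := net_folner VK0 oV V1 cK0 cK sG cov FG.
  set T := \bigcup_(_ in _) _ in cT FT TF.
  have F0 : 0 < #|` F|%:R :> R by rewrite ltr0n cardfs_gt0; apply/fset0Pn; exists g.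
  have vT : 0 < vol T by apply: lt_le_trans FT; exact: mulr_gt0.
  have [x Kx xT] : exists2 x, K x & eps * vol T <= vol (ltranslate x T `+` T).
    apply: contrapT => nx; apply: noF; exists T; split => // x Kx.
    by rewrite ltNge; apply/negP => xT; apply: nx; exists x.
  have := TF _ Kx; rewrite vol_symdiff_ltranslate// in xT.
  rewrite -/U -/W -/Ed; set n := (X in X%:R * _) => nU.
  rewrite /d mulrAC ler_pdivrMr ?mulr_gt0//.
  have : eps * (#|` F|%:R * vol V) <= eps * vol T by rewrite ler_pM2l.
  lra.
have [c [c01 flow]] := flow_exists finE iso.
(* all sets X below lie in Q0, so that b bounds phi2 independently of eta *)
have [Q0 [cQ0 UQ0]] : exists Q0 : set G, compact Q0 /\ U `<=` Q0°.
  exists (setmul U K0); split; first exact: compact_setmul.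
  have oUV : open (setmul U V) by exact: open_setmul.
  apply: (subset_trans (@subset_setmul1 _ U V V1)).
  rewrite -open_subsetE//; move=> _ [u Uu [v Vv <-]].
  by exists u => //; exists v => //; exact: VK0.
have [b Hb] := sparse_bounded sp2 cQ0.
have b0 : 0 <= b.
  apply: le_trans (Hb (fun=> 0) set0 1%g _ _) => //; last by move=> i; rewrite lexx ler01.
  by apply: lfsum_ge0.
(* eta * b < d * vol U, against the surplus d found below *)
pose eta := d * vol U / (2 * (b + 1)).
have b10 : 0 < b + 1 by lra.
have eta0 : 0 < eta by apply: divr_gt0; apply: mulr_gt0.
have [D [N [cD nN DN DQ vD]]] :=
  compact_thicken hG lcG haarh cU (@open_interior _ Q0) UQ0 eta0.
have [oN N1] := nN.
have UD : U `<=` D.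
  by move=> u Uu; have := DN _ _ _ _ Uu N1 N1 N1; rewrite !mulg1.
have DQ0 : D `<=` Q0 by apply: subset_trans DQ _; exact: interior_subset.
pose X := setmul U N.
have oX : open X by exact: open_setmul.
have XQ0 : X `<=` Q0.
  move=> _ [u Uu [n Nn <-]]; apply: DQ0.
  by have := DN _ _ _ _ Uu Nn N1 N1; rewrite !mulg1.
pose phi1 := lfsum Ed c (fun e => rtranslate X e.1).
pose phi2 := lfsum Ed c (fun e => rtranslate X e.2).
have lf1 := sparse_locally_finite sp1 cQ0 XQ0.
have lf2 := sparse_locally_finite sp2 cQ0 XQ0.
have [b1 Hb1] := sparse_bounded sp1 cQ0.
have c0 e : 0 <= c e by have /andP[] := c01 e.
have phi1P : phi1 \in Linfty_pred h.
  apply: (@lfsum_open_Linfty _ _ _ lcG _ _ _ _ b1) => //.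
    by move=> e; exact: open_rtranslate.
  by move=> y; exact: Hb1.
have phi2P : phi2 \in Linfty_pred h.
  apply: (@lfsum_open_Linfty _ _ _ lcG _ _ _ _ b) => //.
    by move=> e; exact: open_rtranslate.
  by move=> y; exact: Hb.
have surplus y : d + phi2 y <= phi1 y.
  pose f : G -> R := \1_[set g | Gam g /\ rtranslate X g y].
  have finf : finite_set [set g | Gam g /\ rtranslate X g y].
    apply: sub_finite_set (sparse_finite y sparseG (compact_setinv cQ0)) => g [Gg Xg].
    by split => //; exact: (rtranslate_mem Xg XQ0).
  have f0 g : 0 <= f g by rewrite /f indicE.
  have fN0 g : f g != 0 -> Gam g /\ rtranslate X g y.
    rewrite /f indicE; case: (boolP (g \in _)) => [/set_mem//|_].
    by rewrite eqxx.
  have suppf : finite_set [set g | f g != 0].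
    by apply: sub_finite_set finf => g; exact: fN0.
  have := flow f f0 suppf (fun g fg => (fN0 g fg).1).
  have mass : 1 <= \sum_(g \in [set: G]) f g.
    have [g Gg [w Ww [v Vv wv]]] := cov y.
    have Xg : rtranslate X g y.
      rewrite rtranslateE /=; apply: (subset_setmul1 N1); rewrite -wv.
      by exists w; [exact: VK0|exists v => //; exact: VK0].
    have fg : f g = 1 by rewrite /f indicE mem_set.
    rewrite -(@fsbig_widen _ _ _ _ [set x | f x != 0] [set: G] f)//; last first.
      by move=> x [_ /negP/negPn/eqP].
    rewrite (fsbigD1 g)//= ?fg ?oner_eq0//.
    by rewrite lerDl fsumr_ge0.
  have -> : \sum_(e \in Ed) c e * (f e.1 - f e.2) = phi1 y - phi2 y.
    have fE g : Gam g -> f g = \1_(rtranslate X g) y.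
      move=> Gg; rewrite /f !indicE; congr (_ : bool)%:R.
      by apply/idP/idP => /set_mem; [case=> _ Xg|move=> Xg]; exact/mem_set.
    rewrite /phi1 /phi2 /lfsum -(@fsumrB _ _ _ _ _
      ([set e | Ed e /\ setinv Q0 (e.1 * y^-1)%g] `|`
       [set e | Ed e /\ setinv Q0 (e.2 * y^-1)%g])).
    - apply: eq_fsbigr => e /set_mem[G1 G2 _].
      by rewrite -!fE// mulrBr.
    - rewrite finite_setU; have cQ0' := compact_setinv cQ0; split.
        exact: (sparse_finite y sp1 cQ0').
      exact: (sparse_finite y sp2 cQ0').
    - move=> e Ee; rewrite indicE; case: (boolP (y \in _)) => [/set_mem Xe _|_].
        by left; split => //; exact: (rtranslate_mem Xe XQ0).
      by rewrite mulr0 eqxx.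
    - move=> e Ee; rewrite indicE; case: (boolP (y \in _)) => [/set_mem Xe _|_].
        by right; split => //; exact: (rtranslate_mem Xe XQ0).
      by rewrite mulr0 eqxx.
  have : d * 1 <= d * \sum_(g \in [set: G]) f g by rewrite ler_pM2l.
  lra.
have m2_ge0 : 0 <= mean_fun mu phi2.
  by apply: (mean_fun_ge0 mmu) => // y; exact: lfsum_ge0.
have m2_le : mean_fun mu phi2 <= b.
  have <- : mean_fun mu (fun=> b * 1) = b.
    by rewrite (mean_funZ mmu b (Linfty_cst h 1)) (mean_fun1 hG lcG haarh mmu) mulr1.
  apply: (le_mean_fun mmu) => //; first exact: Linfty_cst.
  by move=> y; rewrite mulr1; exact: Hb.
have gap : d + mean_fun mu phi2 <= mean_fun mu phi1.
  have dE : mean_fun mu (fun=> d * 1) = d.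
    by rewrite (mean_funZ mmu d (Linfty_cst h 1)) (mean_fun1 hG lcG haarh mmu) mulr1.
  rewrite -{1}dE -(mean_funD mmu)//; last exact: Linfty_cst.
  apply: (le_mean_fun mmu) => //; first by apply: LinftyD => //; exact: Linfty_cst.
  by move=> y; rewrite mulr1; exact: surplus.
have displaced : vol U * mean_fun mu phi1 <= vol D * mean_fun mu phi2.
  apply: (@mean_displaced_le _ _ _ h hG lcG haarh uh mu Ed c snd fst U D N (setinv W)) => //.
  - exact: compact_setinv.
  - by move=> e [_ _ We]; rewrite /setinv /= invgF.
have : vol U * (d + mean_fun mu phi2) <= vol U * mean_fun mu phi1 by rewrite ler_pM2l.
have : (vol D - vol U) * mean_fun mu phi2 <= eta * b.
  have : vol U <= vol D.
    apply: le_vol => //; [exact: (compact_borel_set hG haarh cU)|].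
    exact: (compact_finmeas hG haarh cD).
  by move=> UDv; apply: ler_pM => //; lra.
have etaE : eta * (2 * (b + 1)) = d * vol U by rewrite /eta mulfVK// gt_eqF// mulr_gt0.
have : 0 < eta * (b + 2) by apply: mulr_gt0 => //; lra.
lra.
Qed.
End Folner.

(** * Uniform distributions on compact sets *)

Section UniformMeans.
Context {R : realType} {G : topologicalGroupType}.
Variable h : {measure set (borel G) -> \bar R}.
Hypothesis hG : hausdorff_space G.
Hypothesis lcG : locally_compact [set: G].
Hypothesis haarh : left_haar h.
Variable A : set G.
Hypotheses (cA : compact A) (vA : 0 < vol h A).
Implicit Types (phi : Linfty h) (E : set G).
Local Notation vol := (vol h).

Let mA : measurable (A : set (borel G)).
Proof. exact: (compact_borel_set hG haarh cA). Qed.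

Let finA : (h A < +oo)%E.
Proof. by case: (compact_finmeas hG haarh cA). Qed.

Let measurable_phi phi : measurable_fun (A : set (borel G)) (phi : borel G -> R).
Proof. by have := LinftyP phi; rewrite inE => -[+ _]; exact. Qed.

Lemma integral_norm_le phi (b : R) : loc_ae h [set x | `|phi x| <= b] -> 0 <= b ->
  (\int[h]_(x in A) `|(phi x)%:E| <= (b * vol A)%:E)%E.
Proof.
move=> phib b0; apply: (@le_trans _ _ (\int[h]_(x in A) b%:E)%E).
  apply: ae_ge0_le_integral => //.
  - apply: measurableT_comp => //; exact/measurable_EFinP.
  - have [N [mN N0 sN]] := phib A mA finA.
    exists N; split => // x /= nb; apply: sN; split.
      by move=> /= le; apply: nb => _; rewrite lee_fin.
    by apply: contrapT => nA; apply: nb.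
by rewrite integral_cst// EFinM -volE//; exact: compact_finmeas.
Qed.

Lemma Linfty_integrable phi : h.-integrable A (EFin \o phi).
Proof.
have := LinftyP phi; rewrite inE => -[_ [b phib]].
apply/integrableP; split; first exact/measurable_EFinP.
have phib' : loc_ae h [set x | `|phi x| <= Num.max 0 b].
  move=> F mF Foo; apply: negligibleS (phib F mF Foo) => x [/= nx Fx]; split => //.
  by move=> le; apply: nx; rewrite le_max le orbT.
have b0 : 0 <= Num.max 0 b by rewrite le_max lexx.
by apply: le_lt_trans (integral_norm_le phib' b0) _; rewrite ltry.
Qed.

Lemma mu_E phi : mu_ A phi = (vol A)^-1 * \int[h]_(x in A) phi x.
Proof.
rewrite /mu_ /L1_functional -RintegralZl//; last exact: Linfty_integrable.
rewrite [RHS]Rintegral_mkcond; apply: eq_Rintegral => x _.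
by rewrite patchE indicE; case: ifP => _; rewrite ?mul1r ?mul0r.
Qed.

Lemma mu_indic E : loc_measurable h E -> mean_set (mu_ (h := h) A) E = vol (E `&` A) / vol A.
Proof.
move=> mE; rewrite /mean_set mu_E mulrC; congr (_ / _).
rewrite Linfty_ofK; last exact: Linfty_indic.
have mEA := mE A mA finA.
have fEA : finmeas h (E `&` A).
  exact: (sub_compact_finmeas hG haarh mEA (@subIsetr _ _ _) cA).
have := @Rintegral_step _ _ h unit [:: tt] (fun=> 1) (fun=> E `&` A) (fun=> ler01) (fun=> fEA).
rewrite big_seq1 mul1r => <-; rewrite Rintegral_mkcond.
apply: eq_Rintegral => x _; rewrite big_seq1 mul1r patchE !indicE in_setI.
by case: (x \in A); rewrite ?andbT ?andbF.
Qed.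

Lemma uniform_mean : means h (mu_ A).
Proof.
have vAn0 : vol A != 0 by rewrite gt_eqF.
split.
- move=> a phi psi; rewrite !mu_E.
  have -> : \int[h]_(x in A) (a *: phi + psi) x =
      \int[h]_(x in A) (a * phi x + psi x) by [].
  have iphi : h.-integrable A (EFin \o (fun x => a * phi x)).
    exact: (Linfty_integrable (a *: phi)).
  rewrite RintegralD ?RintegralZl//; try exact: Linfty_integrable.
  by ring.
- apply/eqP; rewrite eq_le; apply/andP; split.
    apply: ub_ereal_sup => _ [phi phi1 <-]; rewrite lee_fin.
    apply/ler_addgt0Pr => e e0.
    have phie := Linfty_norm_ae hG lcG haarh e0 phi1.
    have e1 : 0 <= 1 + e by lra.
    rewrite mu_E normrM ger0_norm ?invr_ge0 ?vol_ge0// ler_pdivrMl// mulrC.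
    apply: le_trans (le_normr_Rintegral _ _) _ => //; first exact: Linfty_integrable.
    have := integral_norm_le phie e1; rewrite /Rintegral.
    move=> le; rewrite -lee_fin fineK//.
    rewrite ge0_fin_numE; last exact: integral_ge0.
    by apply: le_lt_trans le _; rewrite ltry.
  apply: ereal_sup_ubound; exists (Linfty_of h (fun=> 1)) => /=.
    apply: ge_inf; last first.
      by apply: loc_ae_all => x /=; rewrite Linfty_ofK ?normr1//; exact: Linfty_cst.
    exists 0 => c Sc; have [C cC C0] := compact_vol_gt0 hG lcG haarh.
    have [x _ /=] := loc_ae_compact hG haarh Sc cC C0; exact: le_trans.
  rewrite mu_E Linfty_ofK; last exact: Linfty_cst.
  by rewrite Rintegral_cst// mul1r mulVf// normr1.
- move=> phi phi0; rewrite mu_E mulr_ge0 ?invr_ge0 ?vol_ge0//.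
  have -> : \int[h]_(x in A) phi x = \int[h]_(x in A) `|phi x|.
    congr fine; apply: ae_eq_integral => //.
    + exact/measurable_EFinP.
    + by apply/measurable_EFinP; exact: measurableT_comp.
    + have [N [mN N0 sN]] := phi0 A mA finA.
      exists N; split => // x /= nb; apply: sN; split.
        by move=> /= le; apply: nb => _; rewrite ger0_norm.
      by apply: contrapT => nA; apply: nb.
  by apply: Rintegral_ge0.
Qed.

End UniformMeans.

(** * Approximating a mean by disjoint translates *)

Section MeanOfSets.
Context {R : realType} {G : topologicalGroupType}.
Variable h : {measure set (borel G) -> \bar R}.
Implicit Types (A C D E K Q T : set G).
Hypothesis hG : hausdorff_space G.
Hypothesis lcG : locally_compact [set: G].
Hypothesis haarh : left_haar h.
Hypothesis uh : unimodular h.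
Variable mu : Linfty h -> R.
Hypothesis tmu : TLIM h mu.
Local Notation vol := (vol h).
Local Notation M := (mean_fun mu).

Let mmu : means h mu. Proof. by case: tmu. Qed.

Lemma mean_indic_slice E D : loc_measurable h E -> compact D -> 0 < vol D ->
  (fun y => (vol D)^-1 * vol (slice D E y)) \in Linfty_pred h /\
  M \1_E = M (fun y => (vol D)^-1 * vol (slice D E y)).
Proof.
move=> mE cD D0.
pose J := [set tt]; pose c := fun _ : unit => 1 : R; pose F := fun _ : unit => E.
have fJ : locally_finite J F by move=> Q _; apply: sub_finite_set (finite_set1 tt) => i [].
have lfE : lfsum J c F = \1_E.
  by apply/funext => y; rewrite /lfsum fsbig_set1 mul1r.
have cvE : conv_lfsum h D J c F = (fun y => (vol D)^-1 * vol (slice D E y)).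
  by apply/funext => y; rewrite /conv_lfsum fsbig_set1 mul1r.
rewrite -cvE -lfE; split.
  apply: (@conv_lfsum_Linfty _ _ _ hG lcG haarh _ _ _ _ _ 1) => // x.
  by rewrite lfE indicE lern1 leq_b1.
by apply: (TLIM_lfsum hG haarh tmu) => //; rewrite lfE; exact: Linfty_indic.
Qed.

Hypothesis ncG : ~ compact [set: G].

(** A maximal separated set is infinite, since finitely many compact translates
    do not cover [G]; so the disjoint translates of [V] have unbounded total
    volume. *)
Lemma compact_vol_large (r : R) : exists2 D, compact D & r < vol D.
Proof.
have [K0 [cK0 K01 _]] := compact_nbhs1 lcG (@filterT _ (nbhs (1%g : G)) _).
pose V := K0°.
have oV : open V by exact: open_interior.
have V1 : V 1%g by [].
have VK0 : V `<=` K0 by exact: interior_subset.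
have fV := sub_compact_finmeas hG haarh (open_borel_set oV) VK0 cK0.
have vV : 0 < vol V by apply: open_vol_gt0 => //; exists 1%g.
have [Gam [sG cov]] := maximal_separated V1.
have infG : infinite_set Gam.
  move=> fG; apply: ncG.
  have -> : [set: G] = \bigcup_(g in Gam) rtranslate (setmul (setinv K0) K0) g.
    apply/seteqP; split => // p _; have [g Gg [w Ww [v Vv wv]]] := cov p.
    exists g => //; rewrite rtranslateE /= -wv; exists w; first exact: VK0.
    by exists v => //; exact: VK0.
  rewrite -[in X in \bigcup_(_ in X) _](fset_setK fG) bigcup_fset.
  apply: bigsetU_compact => g _; apply: compact_rtranslate.
  by apply: compact_setmul => //; exact: compact_setinv.
have [F FG Fr] := infinite_set_fset (Num.truncn (r / vol V)).+1 infG.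
have FG' : {subset F <= Gam} by move=> g /FG; rewrite inE.
have [cT FT _] := net_folner hG haarh uh VK0 oV V1 cK0 (@compact0 _) sG cov FG'.
exists (\bigcup_(g in [set` F]) rtranslate (setmul (setinv K0) K0) g) => //.
apply: lt_le_trans FT; rewrite -ltr_pdivrMr//.
apply: (@lt_le_trans _ _ (Num.truncn (r / vol V)).+1%:R); first exact: truncnS_gt.
by rewrite ler_nat.
Qed.

(** The convolution of the indicator of [Q] with the uniform density on [D] is at
    most the volume of the inverse of [Q] divided by that of [D]. *)
Lemma mean_compact Q : compact Q -> M \1_Q = 0.
Proof.
move=> cQ; have mQ : loc_measurable h Q.
  by move=> F mF _; apply: measurableI => //; exact: (compact_borel_set hG haarh cQ).
apply/eqP; rewrite eq_le; apply/andP; split; last first.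
  by apply: (mean_fun_ge0 mmu); [exact: Linfty_indic|].
apply/ler_addgt0Pr => e e0; rewrite add0r.
have cQ' := compact_setinv cQ.
have [D cD vD] := compact_vol_large (vol (setinv Q) / e).
have D0 : 0 < vol D by apply: le_lt_trans vD; rewrite divr_ge0 ?vol_ge0// ltW.
have [cvP ->] := mean_indic_slice mQ cD D0.
have <- : M (fun=> e * 1) = e.
  by rewrite (mean_funZ mmu e (Linfty_cst h 1)) (mean_fun1 hG lcG haarh mmu) mulr1.
apply: (le_mean_fun mmu) => //; first exact: Linfty_cst.
move=> y; rewrite mulr1 ler_pdivrMl//.
apply: (@le_trans _ _ (vol (setinv Q))); last by rewrite -ler_pdivrMr// ltW.
rewrite -(vol_ltranslate haarh y (compact_borel_set hG haarh cQ')).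
apply: le_vol; first exact: (borel_set_slice hG haarh).
  by move=> x [_ Qx]; rewrite ltranslateE /setinv /= invgM invgK.
by apply: (compact_finmeas hG haarh); exact: compact_ltranslate.
Qed.

(** The value at [E] of the uniform distribution on [T y], as right translation
    by [y] preserves volume. *)
Definition avg T E (y : G) : R := (vol T)^-1 * vol [set t | T t /\ E (t * y)%g].

Lemma avg_setinv T E y : compact T -> loc_measurable h E ->
  avg T E y = (vol (setinv T))^-1 * vol (slice (setinv T) E y).
Proof.
move=> cT mE; rewrite /avg (vol_setinv hG lcG haarh uh); last first.
  exact: (compact_borel_set hG haarh cT).
have mS := borel_set_slice hG haarh y (compact_setinv cT) mE.
rewrite -(vol_setinv hG lcG haarh uh mS); congr (_ * vol _).
by apply/seteqP; split => t; rewrite /slice /setinv /= !invgK.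
Qed.

Lemma mean_avg T E : compact T -> 0 < vol T -> loc_measurable h E ->
  avg T E \in Linfty_pred h /\ M (avg T E) = M \1_E.
Proof.
move=> cT T0 mE.
have -> : avg T E = fun y => (vol (setinv T))^-1 * vol (slice (setinv T) E y).
  by apply/funext => y; exact: avg_setinv.
have [] := mean_indic_slice mE (compact_setinv cT) _; last by move=> ? ->.
by rewrite (vol_setinv hG lcG haarh uh)//; exact: (compact_borel_set hG haarh cT).
Qed.

Lemma avg_itv T E y : compact T -> 0 < vol T -> loc_measurable h E ->
  0 <= avg T E y <= 1.
Proof.
move=> cT T0 mE; rewrite avg_setinv//.
have T0' : 0 < vol (setinv T).
  by rewrite (vol_setinv hG lcG haarh uh)//; exact: (compact_borel_set hG haarh cT).
rewrite mulr_ge0 ?invr_ge0 ?vol_ge0//= ler_pdivrMl// mulr1.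
by apply: (vol_slice_le hG haarh) => //; exact: compact_setinv.
Qed.

Lemma mean_itv E : loc_measurable h E -> 0 <= M \1_E <= 1.
Proof.
move=> mE; have EP := Linfty_indic mE; apply/andP; split.
  by apply: (mean_fun_ge0 mmu).
rewrite -(mean_fun1 hG lcG haarh mmu); apply: (le_mean_fun mmu) => //.
exact: Linfty_cst.
Qed.

Section Greedy.
Variables (T : set G) (P : seq (set G)).
Hypotheses (cT : compact T) (T0 : 0 < vol T).
Hypothesis mP : forall E, E \in P -> loc_measurable h E.

Definition excess E (y : G) : R := avg T E y - M \1_E.

Lemma excess_norm E y : E \in P -> `|excess E y| <= 1.
Proof.
move=> /mP mE; rewrite /excess ler_norml.
have /andP[? ?] := avg_itv y cT T0 mE; have /andP[? ?] := mean_itv mE.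
by apply/andP; split; lra.
Qed.

(** The mean of the weighted excess is 0, and the mean ignores compact sets, so
    the weighted excess cannot be larger than 1 off a compact set. *)
Lemma excess_step (w : set G -> R) Q : compact Q ->
  exists2 y, ~ Q y & \sum_(E <- P) w E * excess E y <= 1.
Proof.
move=> cQ; apply: contrapT => nex.
have big y : ~ Q y -> 1 < \sum_(E <- P) w E * excess E y.
  by move=> nQ; rewrite ltNge; apply/negP => le1; apply: nex; exists y.
pose w' E := if E \in P then w E else 0.
pose psi y := \sum_(E <- P) w' E * excess E y.
have psiE y : psi y = \sum_(E <- P) w E * excess E y.
  by rewrite /psi big_seq [RHS]big_seq; apply: eq_bigr => E EP; rewrite /w' EP.
have termP E : (fun y => w' E * excess E y) \in Linfty_pred h /\
    M (fun y => w' E * excess E y) = 0.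
  rewrite /w'; case: ifPn => [EP|_]; last first.
    have -> : (fun y => 0 * excess E y) = fun=> 0 by apply/funext => y; rewrite mul0r.
    by split; [exact: Linfty_cst|exact: mean_fun0].
  have [aP aM] := mean_avg cT T0 (mP EP).
  have cP : (fun=> M \1_E) \in Linfty_pred h by exact: Linfty_cst.
  have exP : excess E \in Linfty_pred h by exact: LinftyB.
  split; first exact: LinftyZ.
  rewrite (mean_funZ mmu)// (mean_funB mmu aP cP) aM.
  have -> : M (fun=> M \1_E) = M \1_E.
    transitivity (M (fun=> M \1_E * 1)).
      by congr M; apply/funext => y; rewrite mulr1.
    by rewrite (mean_funZ mmu _ (Linfty_cst h 1)) (mean_fun1 hG lcG haarh mmu) mulr1.
  by rewrite subrr mulr0.
have psiP : psi \in Linfty_pred h by apply: Linfty_sum => E; case: (termP E).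
have psiM : M psi = 0.
  rewrite (mean_fun_sum mmu); last by move=> E; case: (termP E).
  by rewrite big1// => E _; case: (termP E).
(* psi is at least 1 - L everywhere and above 1 off Q *)
pose L := 1 + \sum_(E <- P) `|w E|.
have QP : \1_Q \in Linfty_pred h.
  apply: Linfty_indic => F mF _; apply: measurableI => //.
  exact: (compact_borel_set hG haarh cQ).
have LQP : (fun y => L * \1_Q y) \in Linfty_pred h by exact: LinftyZ.
have : M (fun=> 1) <= M (fun y => psi y + L * \1_Q y).
  apply: (le_mean_fun mmu); [exact: Linfty_cst|exact: LinftyD|move=> y].
  rewrite indicE; have [Qy|nQ] := pselect (Q y); last first.
    by rewrite memNset// mulr0 addr0 psiE ltW//; exact: big.
  rewrite mem_set// mulr1 /L psiE.
  suff : - \sum_(E <- P) w E * excess E y <= \sum_(E <- P) `|w E| by lra.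
  apply: le_trans (ler_norm _) _; rewrite normrN.
  apply: le_trans (ler_norm_sum _ _ _) _.
  rewrite big_seq [leRHS]big_seq; apply: ler_sum => E EP.
  by rewrite normrM ler_piMr// excess_norm.
rewrite (mean_funD mmu)// (mean_funZ mmu)// (mean_compact cQ) psiM mulr0 addr0.
by rewrite (mean_fun1 hG lcG haarh mmu) ler10.
Qed.

(** Blackwell's approachability argument: each new point is chosen far from the
    previous ones and such that its vector of excesses has inner product at most
    1 with the current error vector. The squared length of the latter then grows
    by at most [2 + size P] in each step. *)
Lemma greedy_points n : exists s : seq G, [/\ size s = n, uniq s,
  {in s &, forall x y, rtranslate T x `&` rtranslate T y !=set0 -> x = y} &
  \sum_(E <- P) (\sum_(x <- s) excess E x) ^+ 2 <= n%:R * (2 + (size P)%:R)].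
Proof.
elim: n => [|n [s [sn us ds es]]].
  exists [::]; split => //; rewrite mul0r big1// => E _.
  by rewrite big_nil expr0n.
(* for y outside Q, the translate T y is disjoint from T x for all x in s *)
pose Q := \bigcup_(x in [set` s]) rtranslate (setmul (setinv T) T) x.
have cQ : compact Q.
  rewrite /Q bigcup_seq; apply: bigsetU_compact => x _; apply: compact_rtranslate.
  by apply: compact_setmul => //; exact: compact_setinv.
have [y nQ ey] := excess_step (fun E => \sum_(x <- s) excess E x) cQ.
have disj x : x \in s -> ~ (rtranslate T y `&` rtranslate T x !=set0).
  move=> xs [z [[t Tt tz] [u Tu uz]]]; apply: nQ; exists x => //.
  rewrite rtranslateE /=; exists t^-1%g; first by rewrite /setinv /= invgK.
  exists u => //; apply: (@mulIg _ x); rewrite mulgVK -mulgA uz -tz.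
  by rewrite mulKg.
have Tn0 : T !=set0.
  by apply/set0P; apply: contraTN T0 => /eqP ->; rewrite /vol measure0 ltxx.
have ys : y \notin s.
  apply/negP => ys; apply: (disj _ ys); have [t Tt] := Tn0.
  by exists (t * y)%g; split; exists t.
exists (y :: s); split; rewrite /= ?sn ?ys//.
- move=> a b; rewrite !inE => /predU1P[->|aS] /predU1P[->|bS] // ne.
  + by case: (disj b bS).
  + by case: (disj a aS); rewrite setIC.
  + exact: ds.
- have -> : \sum_(E <- P) (\sum_(x <- y :: s) excess E x) ^+ 2 =
      \sum_(E <- P) (\sum_(x <- s) excess E x) ^+ 2 +
      2 * (\sum_(E <- P) (\sum_(x <- s) excess E x) * excess E y) +
      \sum_(E <- P) excess E y ^+ 2.
    rewrite mulr_sumr -!big_split/=; apply: eq_bigr => E _.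
    by rewrite big_cons; ring.
  have : \sum_(E <- P) excess E y ^+ 2 <= (size P)%:R.
    rewrite -sum1_size natr_sum big_seq [leRHS]big_seq; apply: ler_sum => E EP.
    by rewrite -real_normK ?num_real// expr_le1// excess_norm.
  have : n.+1%:R = n%:R + 1 :> R by rewrite -natr1.
  move=> -> le2; lra.
Qed.

End Greedy.
End MeanOfSets.

Section Assembly.
Context {R : realType} {G : topologicalGroupType}.
Variable h : {measure set (borel G) -> \bar R}.
Implicit Types (A C D E K Q T : set G).
Hypothesis hG : hausdorff_space G.
Hypothesis lcG : locally_compact [set: G].
Hypothesis haarh : left_haar h.
Hypothesis uh : unimodular h.
Local Notation vol := (vol h).
Variables (T : set G) (s : seq G).
Hypotheses (cT : compact T) (us : uniq s).
Hypothesis ds : {in s &, forall x y, rtranslate T x `&` rtranslate T y !=set0 -> x = y}.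
Let A := \bigcup_(x in [set` s]) rtranslate T x.

Lemma compact_translates : compact A.
Proof.
by rewrite /A bigcup_seq; apply: bigsetU_compact => x _; exact: compact_rtranslate.
Qed.

Let sum_seq (F : G -> R) : \sum_(x \in [set` s]) F x = \sum_(x <- s) F x.
Proof. by rewrite -fsbig_seq. Qed.

Lemma vol_translates : vol A = (size s)%:R * vol T.
Proof.
have fT := compact_finmeas hG haarh cT; have [mT _] := fT.
rewrite (vol_fbigcup (finite_seq s)); last 2 first.
- by move=> x y xs ys; exact: ds.
- by move=> x _; exact: finmeas_rtranslate.
rewrite sum_seq (eq_bigr (fun=> vol T)); last by move=> x _; exact: vol_rtranslate.
by rewrite big_const_seq iter_addr_0 count_predT mulr_natl.
Qed.

Lemma vol_translates_symdiff z :
  vol (ltranslate z A `+` A) <= (size s)%:R * vol (ltranslate z T `+` T).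
Proof.
have cA := compact_translates.
have sym_borel C : compact C -> finmeas h (ltranslate z C `+` C).
  move=> cC; have fC := compact_finmeas hG haarh cC; have [mC _] := fC.
  have fzC := finmeas_ltranslate haarh z fC; have [mzC _] := fzC.
  by apply: finmeasU; [apply: finmeas_sub fzC|apply: finmeas_sub fC];
    try exact: measurableD; exact: subDsetl.
have fS := sym_borel T cT; have [mS _] := fS.
apply: (@le_trans _ _ (\sum_(x \in [set` s]) vol (rtranslate (ltranslate z T `+` T) x))).
  apply: vol_fbigcup_le.
  - exact: finite_seq.
  - by move=> x _; exact: finmeas_rtranslate.
  - by case: (sym_borel A cA).
  - move=> y [[[_ [x xs [t Tt <-]] <-] nA]|[[x xs [t Tt <-]] nzA]].
      exists x => //; exists (z * t)%g; last by rewrite mulgA.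
      left; split; first by exists t.
      by move=> Tzt; apply: nA; exists x => //; exists (z * t)%g; rewrite ?mulgA.
    exists x => //; exists t => //; right; split => // -[u Tu ut].
    by apply: nzA; exists (u * x)%g; [exists x => //; exists u|rewrite mulgA ut].
rewrite sum_seq (eq_bigr (fun=> vol (ltranslate z T `+` T))); last first.
  by move=> x _; exact: vol_rtranslate.
by rewrite big_const_seq iter_addr_0 count_predT mulr_natl.
Qed.

Lemma vol_setI_translates E : 0 < vol T -> loc_measurable h E ->
  vol (E `&` A) = vol T * \sum_(x <- s) avg h T E x.
Proof.
move=> T0 mE; have ET x : finmeas h (E `&` rtranslate T x).
  have fTx := finmeas_rtranslate uh x (compact_finmeas hG haarh cT).
  have [mTx Toox] := fTx.
  by apply: (finmeas_sub _ (@subIsetr _ _ _) fTx); exact: mE.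
rewrite /A setI_bigcupr (vol_fbigcup (finite_seq s)); last 2 first.
- by move=> x y xs ys [z [[_ zx] [_ zy]]]; apply: ds => //; exists z.
- by [].
rewrite sum_seq mulr_sumr; apply: eq_bigr => x _.
rewrite /avg mulrA mulfV ?gt_eqF// mul1r.
have [mEx _] := ET x.
rewrite -(vol_rtranslate uh x^-1%g mEx); congr vol.
rewrite rtranslateE invgK; apply/seteqP; split => t /=; rewrite rtranslateE /= mulgK.
  by case.
by case.
Qed.

End Assembly.

Theorem theorem5p9 (R : realType) (G : topologicalGroupType)
    (h : {measure set (borel G) -> \bar R}) :
  hausdorff_space G -> locally_compact [set: G] -> ~ compact [set: G] ->
  left_haar h -> unimodular h ->
  TLIM0 h = TLIM h.
Proof.
move=> hG lcG ncG haarh uh; apply/seteqP; split=> [mu []//|mu tmu].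
split => // P K eps [finP _ mP] cK /andP[e0 e1].
have [T [cT T0 TK]] := folner_exists hG lcG haarh uh tmu cK e0.
pose p := enum_fset (fset_set P).
have pP E : E \in p -> loc_measurable h E.
  by rewrite in_fset_set// inE; exact: mP.
(* n > r amounts to n (2 + size p) < (n eps) ^ 2 *)
pose r : R := (2 + (size p)%:R) / eps ^+ 2.
pose n := (Num.truncn r).+1.
have nr : r < n%:R by exact: truncnS_gt.
have n0 : 0 < n%:R :> R by rewrite ltr0n.
have [s [sn us ds es]] := greedy_points hG lcG haarh uh tmu ncG cT T0 pP n.
pose A := \bigcup_(x in [set` s]) rtranslate T x.
have cA : compact A by exact: compact_translates.
have vA : vol h A = n%:R * vol h T by rewrite /A vol_translates// sn.
have vA0 : 0 < vol h A by rewrite vA mulr_gt0.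
exists A; first split => //.
- by rewrite (volE (compact_finmeas hG haarh cA)) lte_fin.
- move=> x Kx; rewrite -/(vol h _) -/(vol h A) ltr_pdivrMr// vA.
  apply: le_lt_trans (vol_translates_symdiff hG haarh uh cT us x) _.
  by rewrite sn mulrCA ltr_pM2l//; exact: TK.
split; first exact: uniform_mean.
move=> E PE; have Ep : E \in p by rewrite in_fset_set// inE.
have mE := pP _ Ep.
rewrite (mu_indic hG haarh cA mE) (vol_setI_translates hG haarh uh cT us ds T0 mE).
rewrite vA -/(mean_fun mu \1_E); set v := mean_fun mu \1_E.
set S := \sum_(x <- s) _.
have -> : vol h T * S / (n%:R * vol h T) = S / n%:R.
  by rewrite (mulrC n%:R) -mulf_div mulfV ?gt_eqF// mul1r.
have exS : \sum_(x <- s) excess mu T E x = S - n%:R * v.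
  rewrite /excess sumrB; congr (_ - _).
  by rewrite big_const_seq iter_addr_0 count_predT sn mulr_natl.
have : (S - n%:R * v) ^+ 2 <= n%:R * (2 + (size p)%:R).
  apply: le_trans es; rewrite -exS (bigD1_seq E) ?fset_uniq//= lerDl.
  by rewrite sumr_ge0// => F _; exact: sqr_ge0.
move=> bound.
have : (n%:R * (v - S / n%:R)) ^+ 2 < (n%:R * eps) ^+ 2.
  have -> : n%:R * (v - S / n%:R) = - (S - n%:R * v).
    by rewrite mulrBr mulrCA mulfV ?gt_eqF// mulr1 opprB.
  rewrite sqrrN; apply: le_lt_trans bound _.
  rewrite exprMn expr2 -mulrA ltr_pM2l// -ltr_pdivrMr//.
  by rewrite exprn_gt0.
rewrite -[X in X < _]real_normK ?num_real// ltr_pXn2r ?nnegrE ?mulr_ge0 ?(ltW n0) ?(ltW e0)//.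
by rewrite normrM (gtr0_norm n0) ltr_pM2l.
Qed.
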